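(* For each $N\in\mathbb N$ and $z\in\mathbb C^+$, the equation $M(-z-\Xi(M))=I$ has a unique solution $M$ in $\mathcal M_N^+$, and this solution lies in $\mathcal M_N\big(\eta(2K\eta^{-1}+|z|)^{-2},\,4\eta^{-1}\big)$, where $\eta=\Im z$.
   Context: $K\ge1$ integer. For each $N$, $(x_{ij})_{1\le i\le j\le N}$ are real centered random variables with $x_{ij}$ independent of $(x_{kl})_{|i-k|\vee|j-l|>K}$ and $\operatorname{Var}(x_{ij})\le1$; $\xi_{ijkl}=\mathbb E[x_{ij}x_{kl}]$ if $i\le j,k\le l$; $\xi_{ijkl}=\xi_{jilk}$ if $i>j,k>l$; $\xi_{ijkl}=0$ otherwise. $(\Xi(M))_{ik}:=\frac1N\sum_{j,l=1}^N\xi_{ijkl}M_{jl}$. $\|\cdot\|$ is the operator norm. $\mathcal M_N^+=\{M\in\mathbb C^{N\times N}:\frac1{2i}(M-M^* )>0\}$; for $\varepsilon,\delta\ge0$, $\mathcal M_N(\varepsilon,\delta)=\{M:\frac1{2i}(M-M^* )>\varepsilon,\ \|M\|<\delta\}$. *)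

(* Defs.v *)
From Stdlib Require Import Reals Lra Lia.
Open Scope R_scope.

Record Cx := mkC { re : R; im : R }.
Definition C0 : Cx := mkC 0 0.
Definition C1 : Cx := mkC 1 0.
Definition RtoC (r : R) : Cx := mkC r 0.
Definition Cadd (a b : Cx) : Cx := mkC (re a + re b) (im a + im b).
Definition Cneg (a : Cx) : Cx := mkC (- re a) (- im a).
Definition Csub (a b : Cx) : Cx := Cadd a (Cneg b).
Definition Cmul (a b : Cx) : Cx :=
  mkC (re a * re b - im a * im b) (re a * im b + im a * re b).
Definition Cconj (a : Cx) : Cx := mkC (re a) (- im a).
Definition Cnorm2 (a : Cx) : R := re a * re a + im a * im a.
Definition Cabs (a : Cx) : R := sqrt (Cnorm2 a).
Definition Cdiv2i (w : Cx) : Cx := mkC (im w / 2) (- re w / 2).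

Fixpoint Csum (n : nat) (f : nat -> Cx) : Cx :=
  match n with O => C0 | S m => Cadd (Csum m f) (f m) end.
Fixpoint Rsum (n : nat) (f : nat -> R) : R :=
  match n with O => 0 | S m => Rsum m f + f m end.

(* ---------- N x N matrices, vectors in Cx^N (indices 0 .. N-1) ---------- *)
Definition Mat := nat -> nat -> Cx.
Definition Vec := nat -> Cx.

Definition idM : Mat := fun i j => if Nat.eqb i j then C1 else C0.
Definition scalM (z : Cx) : Mat := fun i j => if Nat.eqb i j then z else C0.
Definition addM (A B : Mat) : Mat := fun i j => Cadd (A i j) (B i j).
Definition negM (A : Mat) : Mat := fun i j => Cneg (A i j).
Definition mmul (N : nat) (A B : Mat) : Mat :=
  fun i k => Csum N (fun j => Cmul (A i j) (B j k)).
Definition ImM (A : Mat) : Mat := fun i j => Cdiv2i (Csub (A i j) (Cconj (A j i))).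

Definition mapply (N : nat) (A : Mat) (v : Vec) : Vec :=
  fun i => Csum N (fun j => Cmul (A i j) (v j)).
Definition cinner (N : nat) (u v : Vec) : Cx :=
  Csum N (fun i => Cmul (Cconj (u i)) (v i)).
Definition vnorm (N : nat) (v : Vec) : R := sqrt (Rsum N (fun i => Cnorm2 (v i))).
Definition vnonzero (N : nat) (v : Vec) : Prop := exists i, (i < N)%nat /\ v i <> C0.

(* for a Hermitian H : H > eps  iff  H - eps I is positive definite *)
Definition herm_gt (N : nat) (H : Mat) (eps : R) : Prop :=
  forall v : Vec, vnonzero N v ->
    re (cinner N v (mapply N H v)) - eps * re (cinner N v v) > 0.

Definition is_opnorm (N : nat) (A : Mat) (s : R) : Prop :=
  is_lub (fun r => exists v : Vec, vnorm N v = 1 /\ r = vnorm N (mapply N A v)) s.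
Definition opnorm_lt (N : nat) (A : Mat) (delta : R) : Prop :=
  exists s, is_opnorm N A s /\ s < delta.

Definition MplusN (N : nat) (M : Mat) : Prop := herm_gt N (ImM M) 0.
Definition MN (N : nat) (eps delta : R) (M : Mat) : Prop :=
  herm_gt N (ImM M) eps /\ opnorm_lt N M delta.

(* cov i j k l = E[x_ij x_kl] for i <= j, k <= l (0-based indices). *)
Definition xi (cov : nat -> nat -> nat -> nat -> R) (i j k l : nat) : R :=
  if andb (Nat.leb i j) (Nat.leb k l) then cov i j k l
  else if andb (Nat.ltb j i) (Nat.ltb l k) then cov j i l k
  else 0.

Definition XiOp (N : nat) (cov : nat -> nat -> nat -> nat -> R) (M : Mat) : Mat :=
  fun i k => Cmul (RtoC (/ INR N))
     (Csum N (fun j => Csum N (fun l => Cmul (RtoC (xi cov i j k l)) (M j l)))).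

Definition natdist (a b : nat) : nat := ((a - b) + (b - a))%nat.

(* covariance matrix of the centered family (x_ij)_{i<=j<N}:
   symmetric, positive semidefinite, variances <= 1, K-dependent *)
Definition cov_hyp (N K : nat) (cov : nat -> nat -> nat -> nat -> R) : Prop :=
  (forall i j k l, (i <= j < N)%nat -> (k <= l < N)%nat ->
      cov i j k l = cov k l i j) /\
  (forall c : nat -> nat -> R,
      0 <= Rsum N (fun i => Rsum N (fun j =>
             if Nat.leb i j then
               Rsum N (fun k => Rsum N (fun l =>
                 if Nat.leb k l then c i j * c k l * cov i j k l else 0))
             else 0))) /\
  (forall i j, (i <= j < N)%nat -> cov i j i j <= 1) /\
  (forall i j k l, (i <= j < N)%nat -> (k <= l < N)%nat ->
      (K < Nat.max (natdist i k) (natdist j l))%nat -> cov i j k l = 0).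

Definition MDE (N : nat) (cov : nat -> nat -> nat -> nat -> R) (z : Cx) (M : Mat) : Prop :=
  forall i k, (i < N)%nat -> (k < N)%nat ->
    mmul N M (addM (negM (scalM z)) (negM (XiOp N cov M))) i k = idM i k.

(* Main.v *)
From Stdlib Require Import Reals Lra Lia ClassicalEpsilon.
Require Import Defs.
Open Scope R_scope.

(** Factoring the covariance as a sum of rank-one terms (Cholesky) puts the map [Xi] in Kraus
    form, [<u, Xi(X) v> = 1/N sum_s <B_s^T u, X B_s^T v>], so [Xi] is completely positive.
    Splitting rows by residue modulo [K + 1] makes each column covariance diagonal, whence
    [Xi(I) <= K + 1 <= 2K].  For [Im M >= 0] the matrix [-z - Xi(M)] is coercive, so
    [F(M) = (-z - Xi(M))^-1] is defined, has norm at most [1/eta], and satisfies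
    [Im F(M) = F(M) (eta + Xi(Im M)) F(M)^*].  Combined with
    [F(M) - F(M') = F(M) Xi(M - M') F(M')] and complete positivity, this shows that [F] is a
    strict contraction for the gauge
    [inf {C | 2 Re <u, (M - M') v> <= C (<u, Im M u> + <v, Im M' v>) for all u, v}],
    a hyperbolic-type distance.  Uniqueness follows, and the iterates of [F] from [0] are
    Cauchy entrywise.  In the lower bound on [Im M], equality would force [Xi(M)^* M^* v = 0],
    hence [|v| = |z| |M^* v|], which is incompatible with it. *)

(** * Complex sums and Hermitian forms *)

Lemma Cx_eq (a b : Cx) : re a = re b -> im a = im b -> a = b.
Proof. destruct a, b; simpl; intros; subst; reflexivity. Qed.

Lemma Cx_ring : ring_theory C0 C1 Cadd Cmul Csub Cneg (@eq Cx).
Proof. constructor; intros; try reflexivity; apply Cx_eq; simpl; ring. Qed.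

Add Ring Cx_ring_inst : Cx_ring.

Lemma Csum_ext n f g : (forall i, (i < n)%nat -> f i = g i) -> Csum n f = Csum n g.
Proof.
  induction n; simpl; intros H; [reflexivity|].
  rewrite IHn by (intros; apply H; lia). now rewrite H by lia.
Qed.

Lemma Csum_add n f g : Csum n (fun i => Cadd (f i) (g i)) = Cadd (Csum n f) (Csum n g).
Proof. induction n; simpl; [|rewrite IHn]; ring. Qed.

Lemma Csum_mul_l n c f : Csum n (fun i => Cmul c (f i)) = Cmul c (Csum n f).
Proof. induction n; simpl; [|rewrite IHn]; ring. Qed.

Lemma Csum_mul_r n c f : Csum n (fun i => Cmul (f i) c) = Cmul (Csum n f) c.
Proof. induction n; simpl; [|rewrite IHn]; ring. Qed.

Lemma Csum_zero n f : (forall i, (i < n)%nat -> f i = C0) -> Csum n f = C0.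
Proof.
  induction n; simpl; intros H; [reflexivity|].
  rewrite IHn, H by (try lia; intros; apply H; lia). ring.
Qed.

Lemma Csum_swap n m f :
  Csum n (fun i => Csum m (fun j => f i j)) = Csum m (fun j => Csum n (fun i => f i j)).
Proof.
  induction n; simpl.
  - symmetry; apply Csum_zero; reflexivity.
  - rewrite IHn, <- Csum_add. reflexivity.
Qed.

Lemma Csum_single n k f :
  (k < n)%nat -> (forall i, (i < n)%nat -> i <> k -> f i = C0) -> Csum n f = f k.
Proof.
  induction n; intros Hk H; [lia|]. simpl.
  destruct (Nat.eq_dec n k) as [->|Hn].
  - rewrite Csum_zero by (intros; apply H; lia). ring.
  - rewrite IHn, (H n) by (try lia; intros; apply H; lia). ring.
Qed.

Lemma re_Csum n f : re (Csum n f) = Rsum n (fun i => re (f i)).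
Proof. induction n; simpl; [|rewrite IHn]; reflexivity. Qed.

Lemma im_Csum n f : im (Csum n f) = Rsum n (fun i => im (f i)).
Proof. induction n; simpl; [|rewrite IHn]; reflexivity. Qed.

Lemma Cconj_add a b : Cconj (Cadd a b) = Cadd (Cconj a) (Cconj b).
Proof. apply Cx_eq; simpl; ring. Qed.

Lemma Cconj_mul a b : Cconj (Cmul a b) = Cmul (Cconj a) (Cconj b).
Proof. apply Cx_eq; simpl; ring. Qed.

Lemma Cconj_invol a : Cconj (Cconj a) = a.
Proof. apply Cx_eq; simpl; ring. Qed.

Lemma Cconj_Csum n f : Cconj (Csum n f) = Csum n (fun i => Cconj (f i)).
Proof.
  induction n; simpl; [apply Cx_eq; simpl; ring|]. now rewrite Cconj_add, IHn.
Qed.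

Lemma Rsum_ext n f g : (forall i, (i < n)%nat -> f i = g i) -> Rsum n f = Rsum n g.
Proof.
  induction n; simpl; intros H; [reflexivity|].
  rewrite IHn by (intros; apply H; lia). now rewrite H by lia.
Qed.

Lemma Rsum_add n f g : Rsum n (fun i => f i + g i) = Rsum n f + Rsum n g.
Proof. induction n; simpl; [|rewrite IHn]; ring. Qed.

Lemma Rsum_sub n f g : Rsum n (fun i => f i - g i) = Rsum n f - Rsum n g.
Proof. induction n; simpl; [|rewrite IHn]; ring. Qed.

Lemma Rsum_mul_l n c f : Rsum n (fun i => c * f i) = c * Rsum n f.
Proof. induction n; simpl; [|rewrite IHn]; ring. Qed.

Lemma Rsum_mul_r n c f : Rsum n (fun i => f i * c) = Rsum n f * c.
Proof. induction n; simpl; [|rewrite IHn]; ring. Qed.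

Lemma Rsum_le n f g : (forall i, (i < n)%nat -> f i <= g i) -> Rsum n f <= Rsum n g.
Proof.
  induction n; simpl; intros H; [lra|].
  apply Rplus_le_compat; [apply IHn; intros; apply H; lia | apply H; lia].
Qed.

Lemma Rsum_zero n f : (forall i, (i < n)%nat -> f i = 0) -> Rsum n f = 0.
Proof.
  induction n; simpl; intros H; [reflexivity|].
  rewrite IHn, H by (try lia; intros; apply H; lia). ring.
Qed.

Lemma Rsum_nonneg n f : (forall i, (i < n)%nat -> 0 <= f i) -> 0 <= Rsum n f.
Proof.
  intros H. rewrite <- (Rsum_zero n (fun _ => 0)) by reflexivity. now apply Rsum_le.
Qed.

Lemma Rsum_nonneg_eq0 n f :
  (forall i, (i < n)%nat -> 0 <= f i) -> Rsum n f = 0 -> forall i, (i < n)%nat -> f i = 0.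
Proof.
  induction n; simpl; intros H E i Hi; [lia|].
  assert (0 <= Rsum n f) by (apply Rsum_nonneg; intros; apply H; lia).
  assert (0 <= f n) by (apply H; lia).
  destruct (Nat.eq_dec i n) as [->|Hn]; [lra|].
  apply IHn; [intros; apply H; lia | lra | lia].
Qed.

Lemma Rsum_swap n m f :
  Rsum n (fun i => Rsum m (fun j => f i j)) = Rsum m (fun j => Rsum n (fun i => f i j)).
Proof.
  induction n; simpl.
  - symmetry; apply Rsum_zero; reflexivity.
  - rewrite IHn, <- Rsum_add. reflexivity.
Qed.

Lemma Rsum_single n k f :
  (k < n)%nat -> (forall i, (i < n)%nat -> i <> k -> f i = 0) -> Rsum n f = f k.
Proof.
  induction n; intros Hk H; [lia|]. simpl.
  destruct (Nat.eq_dec n k) as [->|Hn].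
  - rewrite Rsum_zero by (intros; apply H; lia). ring.
  - rewrite IHn, (H n) by (try lia; intros; apply H; lia). ring.
Qed.

Lemma Rsum_const n c : Rsum n (fun _ => c) = INR n * c.
Proof. induction n; [simpl; ring|]. rewrite S_INR. simpl. rewrite IHn. ring. Qed.

Lemma Rsum_cat n m f : Rsum (n + m) f = Rsum n f + Rsum m (fun i => f (n + i)%nat).
Proof.
  induction m; simpl; [rewrite Nat.add_0_r; ring|].
  rewrite Nat.add_succ_r. simpl. rewrite IHm. ring.
Qed.

Lemma Rsum_flatten n m f :
  Rsum (n * m) f = Rsum n (fun i => Rsum m (fun j => f (i * m + j)%nat)).
Proof.
  induction n; [reflexivity|].
  simpl Nat.mul. rewrite Nat.add_comm, Rsum_cat, IHn. reflexivity.
Qed.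

(** Cauchy-Schwarz against the constant vector: the double sum of [(f i - f j)^2] is twice the gap
    between the two sides. *)
Lemma Rsum_sqr_le n f : Rsum n f * Rsum n f <= INR n * Rsum n (fun i => f i * f i).
Proof.
  assert (H : 0 <= Rsum n (fun i => Rsum n (fun j => (f i - f j) * (f i - f j)))).
  { apply Rsum_nonneg; intros; apply Rsum_nonneg; intros; apply Rle_0_sqr. }
  assert (E : Rsum n (fun i => Rsum n (fun j => (f i - f j) * (f i - f j))) =
              2 * (INR n * Rsum n (fun i => f i * f i)) - 2 * (Rsum n f * Rsum n f)).
  { transitivity (Rsum n (fun i => INR n * (f i * f i) + (Rsum n (fun j => f j * f j)
                     + (-2 * Rsum n f) * f i))).
    - apply Rsum_ext; intros i _.
      rewrite <- Rsum_const.
      replace (-2 * Rsum n f * f i) with (Rsum n (fun j => (-2 * f i) * f j))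
        by (rewrite Rsum_mul_l; ring).
      rewrite <- !Rsum_add. apply Rsum_ext; intros; ring.
    - rewrite !Rsum_add, !Rsum_mul_l, Rsum_const. ring. }
  lra.
Qed.

Definition sqnorm (N : nat) (v : Vec) : R := Rsum N (fun i => Cnorm2 (v i)).
Definition vadd (u v : Vec) : Vec := fun i => Cadd (u i) (v i).
Definition vscal (c : Cx) (v : Vec) : Vec := fun i => Cmul c (v i).
Definition adj (A : Mat) : Mat := fun i j => Cconj (A j i).
Definition subM (A B : Mat) : Mat := addM A (negM B).

Lemma cinner_ext N u u' v v' :
  (forall i, (i < N)%nat -> u i = u' i) -> (forall i, (i < N)%nat -> v i = v' i) ->
  cinner N u v = cinner N u' v'.
Proof. intros H H'; apply Csum_ext; intros. now rewrite H, H'. Qed.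

Lemma cinner_add_r N u v v' : cinner N u (vadd v v') = Cadd (cinner N u v) (cinner N u v').
Proof.
  unfold cinner; rewrite <- Csum_add; apply Csum_ext; intros. unfold vadd; ring.
Qed.

Lemma cinner_scal_l N c u v : cinner N (vscal c u) v = Cmul (Cconj c) (cinner N u v).
Proof.
  unfold cinner; rewrite <- Csum_mul_l; apply Csum_ext; intros.
  unfold vscal; rewrite Cconj_mul; ring.
Qed.

Lemma cinner_scal_r N c u v : cinner N u (vscal c v) = Cmul c (cinner N u v).
Proof.
  unfold cinner; rewrite <- Csum_mul_l; apply Csum_ext; intros. unfold vscal; ring.
Qed.

Lemma cinner_conj N u v : Cconj (cinner N u v) = cinner N v u.
Proof.
  unfold cinner; rewrite Cconj_Csum; apply Csum_ext; intros.
  rewrite Cconj_mul, Cconj_invol; ring.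
Qed.

Lemma cinner_self N v : cinner N v v = RtoC (sqnorm N v).
Proof.
  apply Cx_eq; simpl.
  - unfold cinner, sqnorm; rewrite re_Csum; apply Rsum_ext; intros.
    unfold Cnorm2; simpl; ring.
  - unfold cinner; rewrite im_Csum; apply Rsum_zero; intros; simpl; ring.
Qed.

Lemma sqnorm_nonneg N v : 0 <= sqnorm N v.
Proof. apply Rsum_nonneg; intros; unfold Cnorm2; nra. Qed.

Lemma sqnorm_scal N c v : sqnorm N (vscal c v) = Cnorm2 c * sqnorm N v.
Proof.
  unfold sqnorm; rewrite <- Rsum_mul_l; apply Rsum_ext; intros; unfold vscal, Cnorm2; simpl; ring.
Qed.

Lemma sqnorm_eq0 N v : sqnorm N v = 0 -> forall i, (i < N)%nat -> v i = C0.
Proof.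
  intros H i Hi. apply Rsum_nonneg_eq0 with (i := i) in H; auto.
  - unfold Cnorm2 in H. apply Cx_eq; simpl; nra.
  - intros; unfold Cnorm2; nra.
Qed.

Lemma sqnorm_pos N v : vnonzero N v -> 0 < sqnorm N v.
Proof.
  intros [i [Hi H]]. destruct (Rle_lt_or_eq_dec _ _ (sqnorm_nonneg N v)) as [|E]; [assumption|].
  now elim H; apply (sqnorm_eq0 N).
Qed.

Lemma two_re_cinner_le N u v : 2 * re (cinner N u v) <= sqnorm N u + sqnorm N v.
Proof.
  unfold cinner, sqnorm; rewrite re_Csum, <- Rsum_mul_l, <- Rsum_add.
  apply Rsum_le; intros; unfold Cnorm2; cbn [re im Cmul Cconj].
  pose proof (Rle_0_sqr (re (u i) - re (v i))); pose proof (Rle_0_sqr (im (u i) - im (v i))).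
  unfold Rsqr in *. lra.
Qed.

(** The unweighted inequality at [t * u] and [v], divided by [t]. A suitable [t] later recovers the
    sharp product bound that Cauchy-Schwarz would give. *)
Lemma two_re_cinner_le_weighted N t u v :
  0 < t -> 2 * re (cinner N u v) <= t * sqnorm N u + / t * sqnorm N v.
Proof.
  intros Ht. pose proof (two_re_cinner_le N (vscal (RtoC t) u) v) as H.
  rewrite cinner_scal_l, sqnorm_scal in H. unfold Cnorm2 in H; simpl in H.
  apply (Rmult_le_reg_l t); [assumption|].
  replace (t * (t * sqnorm N u + / t * sqnorm N v)) with (t * t * sqnorm N u + sqnorm N v)
    by (field; lra).
  lra.
Qed.

Lemma mapply_ext N A B u v i :
  (forall j, (j < N)%nat -> A i j = B i j) -> (forall j, (j < N)%nat -> u j = v j) ->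
  mapply N A u i = mapply N B v i.
Proof. intros H H'; apply Csum_ext; intros. now rewrite H, H'. Qed.

Lemma mapply_addM N A B v i :
  mapply N (addM A B) v i = Cadd (mapply N A v i) (mapply N B v i).
Proof. unfold mapply; rewrite <- Csum_add; apply Csum_ext; intros; unfold addM; ring. Qed.

Lemma mapply_negM N A v i : mapply N (negM A) v i = Cneg (mapply N A v i).
Proof.
  replace (Cneg (mapply N A v i)) with (Cmul (Cneg C1) (mapply N A v i)) by ring.
  unfold mapply; rewrite <- Csum_mul_l; apply Csum_ext; intros; unfold negM; ring.
Qed.

Lemma mapply_scalM N z v i : (i < N)%nat -> mapply N (scalM z) v i = Cmul z (v i).
Proof.
  intros Hi; unfold mapply. rewrite (Csum_single N i); auto; unfold scalM.
  - now rewrite Nat.eqb_refl.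
  - intros j _ Hj. destruct (Nat.eqb_spec i j); [lia|ring].
Qed.

Lemma mapply_idM N v i : (i < N)%nat -> mapply N idM v i = v i.
Proof.
  intros Hi. change idM with (scalM C1). rewrite mapply_scalM by assumption. ring.
Qed.

Lemma mapply_vadd N A u v i :
  mapply N A (vadd u v) i = Cadd (mapply N A u i) (mapply N A v i).
Proof. unfold mapply; rewrite <- Csum_add; apply Csum_ext; intros; unfold vadd; ring. Qed.

Lemma mapply_vscal N A c v i : mapply N A (vscal c v) i = Cmul c (mapply N A v i).
Proof. unfold mapply; rewrite <- Csum_mul_l; apply Csum_ext; intros; unfold vscal; ring. Qed.

Lemma mapply_mmul N A B v i : mapply N (mmul N A B) v i = mapply N A (mapply N B v) i.
Proof.
  unfold mapply, mmul.
  transitivity (Csum N (fun j => Csum N (fun k => Cmul (Cmul (A i k) (B k j)) (v j)))).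
  - apply Csum_ext; intros; now rewrite <- Csum_mul_r.
  - rewrite Csum_swap; apply Csum_ext; intros.
    rewrite <- Csum_mul_l; apply Csum_ext; intros; ring.
Qed.

Lemma cinner_adj N u A v : cinner N (mapply N (adj A) u) v = cinner N u (mapply N A v).
Proof.
  unfold cinner, mapply, adj.
  transitivity (Csum N (fun i => Csum N (fun j => Cmul (Cmul (A j i) (Cconj (u j))) (v i)))).
  - apply Csum_ext; intros. rewrite Cconj_Csum, <- Csum_mul_r. apply Csum_ext; intros.
    now rewrite Cconj_mul, Cconj_invol.
  - rewrite Csum_swap; apply Csum_ext; intros. rewrite <- Csum_mul_l; apply Csum_ext; intros; ring.
Qed.

Lemma cinner_mapply_subM N u A B v :
  cinner N u (mapply N (subM A B) v) =
  Csub (cinner N u (mapply N A v)) (cinner N u (mapply N B v)).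
Proof.
  replace (Csub (cinner N u (mapply N A v)) (cinner N u (mapply N B v))) with
    (Cadd (cinner N u (mapply N A v)) (Cmul (Cneg C1) (cinner N u (mapply N B v)))) by ring.
  rewrite <- cinner_scal_r, <- cinner_add_r. apply cinner_ext; auto; intros.
  unfold subM, vadd, vscal. rewrite mapply_addM, mapply_negM. ring.
Qed.

(** Reduces positivity of the matrix [ImM A] to the imaginary part of the form of [A], the only
    shape in which it is used afterwards. *)
Lemma re_cinner_ImM N A v :
  re (cinner N v (mapply N (ImM A) v)) = im (cinner N v (mapply N A v)).
Proof.
  (* The constant [mkC 0 (-/2)] is [1/(2i)]. *)
  assert (E : cinner N v (mapply N (ImM A) v) =
     Cmul (mkC 0 (-/2)) (Csub (cinner N v (mapply N A v)) (Cconj (cinner N v (mapply N A v))))).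
  { rewrite cinner_conj, <- (cinner_conj N v (mapply N A v)), cinner_conj.
    rewrite <- (Cconj_invol (cinner N (mapply N A v) v)), cinner_conj.
    transitivity (cinner N v (vscal (mkC 0 (-/2)) (mapply N (subM A (adj A)) v))).
    - apply cinner_ext; auto; intros. unfold vscal, mapply. rewrite <- Csum_mul_l.
      apply Csum_ext; intros. apply Cx_eq; unfold ImM, subM, addM, negM, adj; simpl; field.
    - rewrite cinner_scal_r, cinner_mapply_subM.
      f_equal. f_equal. rewrite cinner_conj.
      rewrite <- (cinner_adj N v (adj A) v). unfold adj.
      apply cinner_ext; auto; intros; apply mapply_ext; auto; intros. now rewrite Cconj_invol. }
  rewrite E. simpl. field.
Qed.

Definition basis (k : nat) : Vec := fun i => if Nat.eqb i k then C1 else C0.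

Lemma mapply_basis N A i k : (k < N)%nat -> mapply N A (basis k) i = A i k.
Proof.
  intros Hk; unfold mapply. rewrite (Csum_single N k); auto; unfold basis.
  - rewrite Nat.eqb_refl; ring.
  - intros j _ Hj. destruct (Nat.eqb_spec j k); [lia|ring].
Qed.

Lemma cinner_basis_l N v k : (k < N)%nat -> cinner N (basis k) v = v k.
Proof.
  intros Hk; unfold cinner. rewrite (Csum_single N k); auto; unfold basis.
  - rewrite Nat.eqb_refl. apply Cx_eq; simpl; ring.
  - intros j _ Hj. destruct (Nat.eqb_spec j k); [lia|]. apply Cx_eq; simpl; ring.
Qed.

Lemma sqnorm_basis N k : (k < N)%nat -> sqnorm N (basis k) = 1.
Proof.
  intros Hk; unfold sqnorm. rewrite (Rsum_single N k); auto; unfold basis, Cnorm2.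
  - rewrite Nat.eqb_refl; simpl; ring.
  - intros j _ Hj. destruct (Nat.eqb_spec j k); [lia|simpl; ring].
Qed.

(** * Cholesky factorization of the covariance *)

Definition quad (n : nat) (A : nat -> nat -> R) (c : nat -> R) : R :=
  Rsum n (fun p => Rsum n (fun q => c p * c q * A p q)).

Lemma quad_S n A c :
  (forall p, (p < n)%nat -> A n p = A p n) ->
  quad (S n) A c =
  quad n A c + 2 * c n * Rsum n (fun p => c p * A p n) + c n * c n * A n n.
Proof.
  intros Hs. unfold quad; simpl. rewrite Rsum_add.
  replace (Rsum n (fun q => c n * c q * A n q)) with (c n * Rsum n (fun p => c p * A p n)).
  2:{ rewrite <- Rsum_mul_l; apply Rsum_ext; intros; rewrite Hs by assumption; ring. }
  replace (Rsum n (fun i => c i * c n * A i n)) with (c n * Rsum n (fun p => c p * A p n)).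
  2:{ rewrite <- Rsum_mul_l; apply Rsum_ext; intros; ring. }
  ring.
Qed.

Definition upd (c : nat -> R) (n : nat) (x : R) : nat -> R :=
  fun p => if Nat.eqb p n then x else c p.

Lemma upd_same c n x : upd c n x n = x.
Proof. unfold upd; now rewrite Nat.eqb_refl. Qed.

Lemma upd_lt c n x p : (p < n)%nat -> upd c n x p = c p.
Proof. intros; unfold upd; destruct (Nat.eqb_spec p n); [lia|reflexivity]. Qed.

Lemma quad_upd n A c x :
  (forall p, (p < n)%nat -> A n p = A p n) ->
  quad (S n) A (upd c n x) =
  quad n A c + 2 * x * Rsum n (fun p => c p * A p n) + x * x * A n n.
Proof.
  intros Hs. rewrite quad_S by assumption. rewrite upd_same. f_equal; f_equal.
  - apply Rsum_ext; intros; apply Rsum_ext; intros. now rewrite !upd_lt.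
  - f_equal; apply Rsum_ext; intros. now rewrite upd_lt.
Qed.

(** Induction eliminating the last index. A positive pivot is removed by subtracting a rank-one
    matrix; a zero pivot forces its whole column to vanish, by semidefiniteness. *)
Lemma cholesky n : forall A : nat -> nat -> R,
  (forall p q, (p < n)%nat -> (q < n)%nat -> A p q = A q p) ->
  (forall c, 0 <= quad n A c) ->
  exists g : nat -> nat -> R, forall p q, (p < n)%nat -> (q < n)%nat ->
    A p q = Rsum n (fun s => g s p * g s q).
Proof.
  induction n as [|n IH]; intros A Hs Hp.
  { exists (fun _ _ => 0); intros; lia. }
  assert (Hs' : forall p, (p < n)%nat -> A n p = A p n) by (intros; apply Hs; lia).
  assert (Ha : 0 <= A n n).
  { specialize (Hp (upd (fun _ => 0) n 1)). rewrite quad_upd in Hp by assumption.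
    replace (quad n A (fun _ => 0)) with 0 in Hp.
    - rewrite Rsum_zero in Hp by (intros; ring). lra.
    - symmetry; apply Rsum_zero; intros; apply Rsum_zero; intros; ring. }
  destruct (Rle_lt_or_eq_dec _ _ Ha) as [Ha'|Ha'].
  - set (a := A n n) in *.
    (* Schur complement of the pivot [a]. *)
    destruct (IH (fun p q => A p q - A p n * A q n / a)) as [g Hg].
    + intros. rewrite (Hs p q) by lia. field; lra.
    + intros c. specialize (Hp (upd c n (- Rsum n (fun p => c p * A p n) / a))).
      rewrite quad_upd in Hp by assumption. fold a in Hp.
      set (S1 := Rsum n (fun p => c p * A p n)) in *.
      replace (quad n (fun p q => A p q - A p n * A q n / a) c) with (quad n A c - S1 * S1 / a).
      { replace (quad n A c - S1 * S1 / a) with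
          (quad n A c + 2 * (- S1 / a) * S1 + - S1 / a * (- S1 / a) * a) by (field; lra).
        exact Hp. }
      unfold quad. replace (S1 * S1 / a) with (Rsum n (fun p => Rsum n (fun q =>
         (c p * A p n) * (c q * A q n / a)))).
      * replace (Rsum n (fun p => Rsum n (fun q => c p * c q * (A p q - A p n * A q n / a))))
          with (Rsum n (fun p => Rsum n (fun q => c p * c q * A p q)
              + (-1) * Rsum n (fun q => c p * A p n * (c q * A q n / a)))).
        { rewrite Rsum_add, Rsum_mul_l. ring. }
        apply Rsum_ext; intros. rewrite <- Rsum_mul_l, <- Rsum_add.
        apply Rsum_ext; intros. field; lra.
      * unfold S1 at 1. unfold Rdiv. rewrite Rmult_assoc, <- Rsum_mul_r.
        apply Rsum_ext; intros. rewrite Rsum_mul_l. f_equal.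
        unfold S1. rewrite <- Rsum_mul_r. apply Rsum_ext; intros; ring.
    + exists (fun s p => if Nat.eqb s n then A p n / sqrt a else
                         if Nat.eqb p n then 0 else g s p).
      intros p q Hpn Hqn. cbn [Rsum]. rewrite Nat.eqb_refl.
      assert (Hsq : sqrt a * sqrt a = a) by (apply sqrt_sqrt; lra).
      assert (0 < sqrt a) by (apply sqrt_lt_R0; lra).
      replace (A p n / sqrt a * (A q n / sqrt a)) with (A p n * A q n / a)
        by (rewrite <- Hsq at 1; field; lra).
      destruct (Nat.eq_dec p n) as [->|Hp1]; [|destruct (Nat.eq_dec q n) as [->|Hq1]].
      * rewrite Rsum_zero.
        { fold a. rewrite (Hs n q) by lia. field; lra. }
        intros; rewrite Nat.eqb_refl. destruct (Nat.eqb_spec i n); [lia|ring].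
      * rewrite Rsum_zero.
        { fold a. field; lra. }
        intros; rewrite (Nat.eqb_refl n). destruct (Nat.eqb_spec i n); [lia|ring].
      * rewrite <- (Rsum_ext n (fun s => g s p * g s q)).
        { rewrite <- Hg by lia. ring. }
        intros. destruct (Nat.eqb_spec i n), (Nat.eqb_spec p n), (Nat.eqb_spec q n); try lia; ring.
  - assert (H0 : forall p, (p < n)%nat -> A p n = 0).
    { intros p Hpn.
      (* With zero pivot the form at [e_p + x e_n] is affine in [x], so nonnegativity for all [x]
         forces its slope to be zero. *)
      assert (Hx : forall x, 0 <= A p p + 2 * x * A p n).
      { intros x. specialize (Hp (upd (upd (fun _ => 0) p 1) n x)).
        rewrite quad_upd in Hp by assumption. rewrite <- Ha' in Hp.
        unfold quad in Hp.
        rewrite (Rsum_single n p) in Hp by (try assumption; intros; apply Rsum_zero; intros;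
          unfold upd; destruct (Nat.eqb_spec i p); (lia || ring)).
        rewrite (Rsum_single n p) in Hp by (try assumption; intros;
          unfold upd; destruct (Nat.eqb_spec i p); (lia || ring)).
        rewrite (Rsum_single n p) in Hp by (try assumption; intros;
          unfold upd; destruct (Nat.eqb_spec i p); (lia || ring)).
        rewrite !upd_same in Hp. lra. }
      destruct (Req_dec (A p n) 0) as [|Hn]; [assumption|].
      specialize (Hx (- (A p p + 1) / (2 * A p n))).
      replace (A p p + 2 * (- (A p p + 1) / (2 * A p n)) * A p n) with (-1) in Hx
        by (field; assumption). lra. }
    destruct (IH A) as [g Hg].
    + intros; apply Hs; lia.
    + intros c. specialize (Hp (upd c n 0)). rewrite quad_upd in Hp by assumption. lra.
    + exists (fun s p => if Nat.eqb s n then 0 else if Nat.eqb p n then 0 else g s p).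
      intros p q Hpn Hqn. cbn [Rsum]. rewrite Nat.eqb_refl.
      destruct (Nat.eq_dec p n) as [->|Hp1]; [|destruct (Nat.eq_dec q n) as [->|Hq1]].
      * rewrite Rsum_zero.
        { destruct (Nat.eq_dec q n) as [->|]; [lra|]. rewrite Hs', H0 by lia. ring. }
        intros; rewrite Nat.eqb_refl. destruct (Nat.eqb_spec i n); [lia|ring].
      * rewrite Rsum_zero.
        { rewrite H0 by lia. ring. }
        intros; rewrite (Nat.eqb_refl n). destruct (Nat.eqb_spec i n); [lia|ring].
      * rewrite <- (Rsum_ext n (fun s => g s p * g s q)).
        { rewrite <- Hg by lia. ring. }
        intros. destruct (Nat.eqb_spec i n), (Nat.eqb_spec p n), (Nat.eqb_spec q n); try lia; ring.
Qed.

Lemma flat_div N i j : (j < N)%nat -> ((i * N + j) / N = i)%nat.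
Proof. intros. rewrite Nat.div_add_l, Nat.div_small by lia. lia. Qed.

Lemma flat_mod N i j : (j < N)%nat -> ((i * N + j) mod N = j)%nat.
Proof. intros. rewrite Nat.add_comm, Nat.Div0.mod_add, Nat.mod_small; lia. Qed.

(* The family [B] lists the coefficients of the upper triangular half of the random matrix
   and of its strictly lower triangular transpose, so that [xi] is a sum of rank-one terms. *)
Lemma xi_factorization N K cov :
  cov_hyp N K cov ->
  exists (m : nat) (B : nat -> nat -> nat -> R),
  forall i j k l, (i < N)%nat -> (j < N)%nat -> (k < N)%nat -> (l < N)%nat ->
    xi cov i j k l = Rsum m (fun s => B s i j * B s k l).
Proof.
  intros [Hsym [Hpos _]].
  (* The covariance is extended by zero off the upper triangle, and pairs [(i, j)] are flattened to
     [i * N + j], so that [cholesky] applies to one matrix of size [N * N]. *)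
  set (cv := fun i j k l => if Nat.leb i j then if Nat.leb k l then cov i j k l else 0 else 0).
  set (A := fun p q => cv (p / N)%nat (p mod N)%nat (q / N)%nat (q mod N)%nat).
  destruct (cholesky (N * N) A) as [g Hg].
  - intros p q Hp Hq. unfold A, cv.
    assert (HN : (N <> 0)%nat) by lia.
    pose proof (Nat.mod_upper_bound p N HN). pose proof (Nat.mod_upper_bound q N HN).
    destruct (Nat.leb_spec (p / N) (p mod N)), (Nat.leb_spec (q / N) (q mod N)); auto.
  - intros c. specialize (Hpos (fun i j => c (i * N + j)%nat)).
    refine (Rle_trans _ _ _ Hpos (Req_le _ _ _)).
    unfold quad. rewrite Rsum_flatten. apply Rsum_ext; intros i Hi; apply Rsum_ext; intros j Hj.
    rewrite Rsum_flatten. unfold A. rewrite flat_div, flat_mod by assumption. unfold cv.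
    destruct (Nat.leb i j).
    + apply Rsum_ext; intros k Hk; apply Rsum_ext; intros l Hl.
      rewrite flat_div, flat_mod by assumption. destruct (Nat.leb k l); ring.
    + symmetry; apply Rsum_zero; intros; apply Rsum_zero; intros; ring.
  - assert (Hcv : forall i j k l, (i < N)%nat -> (j < N)%nat -> (k < N)%nat -> (l < N)%nat ->
      cv i j k l = Rsum (N * N) (fun s => g s (i * N + j)%nat * g s (k * N + l)%nat)).
    { intros. rewrite <- Hg by nia. unfold A. now rewrite !flat_div, !flat_mod. }
    exists (N * N + N * N)%nat.
    exists (fun s i j => if Nat.ltb s (N * N) then if Nat.leb i j then g s (i * N + j)%nat else 0
      else if Nat.leb i j then 0 else g (s - N * N)%nat (j * N + i)%nat).
    intros i j k l Hi Hj Hk Hl. rewrite Rsum_cat.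
    (* For each [s] the matrix [B s] is supported in one of the two halves, so no mixed terms arise,
       in agreement with [xi] vanishing there. *)
    transitivity ((if Nat.leb i j then if Nat.leb k l then cv i j k l else 0 else 0) +
                  (if Nat.leb i j then 0 else if Nat.leb k l then 0 else cv j i l k)).
    + unfold xi, cv.
      destruct (Nat.leb_spec i j), (Nat.leb_spec k l), (Nat.ltb_spec j i), (Nat.ltb_spec l k),
        (Nat.leb_spec j i), (Nat.leb_spec l k); simpl; try lia; ring.
    + f_equal.
      * destruct (Nat.leb i j); [destruct (Nat.leb k l)|].
        -- rewrite Hcv by assumption. apply Rsum_ext; intros s Hs.
           destruct (Nat.ltb_spec s (N * N)); [reflexivity|lia].
        -- symmetry; apply Rsum_zero; intros; destruct (Nat.ltb_spec i0 (N * N)); [ring|lia].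
        -- symmetry; apply Rsum_zero; intros; destruct (Nat.ltb_spec i0 (N * N)); [ring|lia].
      * destruct (Nat.leb i j); [|destruct (Nat.leb k l)].
        -- symmetry; apply Rsum_zero; intros; destruct (Nat.ltb_spec (N * N + i0) (N * N)); [lia|ring].
        -- symmetry; apply Rsum_zero; intros; destruct (Nat.ltb_spec (N * N + i0) (N * N)); [lia|ring].
        -- rewrite Hcv by assumption. apply Rsum_ext; intros s Hs.
           destruct (Nat.ltb_spec (N * N + s) (N * N)); [lia|].
           replace (N * N + s - N * N)%nat with s by lia. reflexivity.
Qed.

Lemma xi_diag_le N K cov i j :
  cov_hyp N K cov -> (i < N)%nat -> (j < N)%nat -> xi cov i j i j <= 1.
Proof.
  intros (_ & _ & Hv & _) Hi Hj. unfold xi.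
  destruct (Nat.leb_spec i j); simpl; [apply Hv; lia|].
  destruct (Nat.ltb_spec j i); simpl; [apply Hv; lia|lra].
Qed.

(** In the lower triangular case rows and columns are exchanged, which leaves the maximum of the two
    distances unchanged; so row distance alone suffices. *)
Lemma xi_far N K cov i j k l :
  cov_hyp N K cov -> (i < N)%nat -> (j < N)%nat -> (k < N)%nat -> (l < N)%nat ->
  (K < natdist i k)%nat -> xi cov i j k l = 0.
Proof.
  intros (_ & _ & _ & Hd) Hi Hj Hk Hl H. unfold xi.
  destruct (Nat.leb_spec i j), (Nat.leb_spec k l), (Nat.ltb_spec j i), (Nat.ltb_spec l k);
    simpl; try lra; apply Hd; lia.
Qed.

(** * Inversion of coercive matrices *)

Definition Cinv (a : Cx) : Cx := mkC (re a / Cnorm2 a) (- im a / Cnorm2 a).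

Lemma Cmul_Cinv_r a : im a <> 0 -> Cmul a (Cinv a) = C1.
Proof.
  intros H. assert (re a * re a + im a * im a <> 0).
  { pose proof (Rle_0_sqr (re a)). assert (0 < im a * im a) by (apply Rsqr_pos_lt; assumption).
    unfold Rsqr in *; lra. }
  apply Cx_eq; unfold Cinv, Cnorm2; simpl; field; assumption.
Qed.

Definition vext (n : nat) (x : Vec) (t : Cx) : Vec := fun i => if Nat.eqb i n then t else x i.

Lemma vext_same n x t : vext n x t n = t.
Proof. unfold vext; now rewrite Nat.eqb_refl. Qed.

Lemma vext_lt n x t i : (i < n)%nat -> vext n x t i = x i.
Proof. intros; unfold vext; destruct (Nat.eqb_spec i n); [lia|reflexivity]. Qed.

Lemma mapply_vext n A x t i :
  mapply (S n) A (vext n x t) i = Cadd (mapply n A x i) (Cmul (A i n) t).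
Proof.
  unfold mapply; simpl. rewrite vext_same. f_equal. apply Csum_ext; intros. now rewrite vext_lt.
Qed.

Lemma cinner_vext n x t w :
  cinner (S n) (vext n x t) w = Cadd (cinner n x w) (Cmul (Cconj t) (w n)).
Proof.
  unfold cinner; simpl. rewrite vext_same. f_equal. apply Csum_ext; intros. now rewrite vext_lt.
Qed.

Lemma sqnorm_vext n x t : sqnorm (S n) (vext n x t) = sqnorm n x + Cnorm2 t.
Proof.
  unfold sqnorm; simpl. rewrite vext_same. f_equal. apply Rsum_ext; intros. now rewrite vext_lt.
Qed.

(* Gaussian elimination: the Schur complement [s] of the leading block is nonzero because the
   form of the matrix at [(-x, 1)] equals [s]. *)
Lemma coercive_solve e (He : 0 < e) n : forall A,
  (forall v, e * sqnorm n v <= - im (cinner n v (mapply n A v))) ->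
  forall b, exists x, forall i, (i < n)%nat -> mapply n A x i = b i.
Proof.
  induction n as [|n IH]; intros A HA b.
  { exists b; intros; lia. }
  assert (HA' : forall v, e * sqnorm n v <= - im (cinner n v (mapply n A v))).
  (* Padding by zero shows that the leading block inherits coercivity. *)
  { intros v. specialize (HA (vext n v C0)). rewrite sqnorm_vext, cinner_vext in HA.
    replace (cinner n v (mapply (S n) A (vext n v C0))) with (cinner n v (mapply n A v)) in HA.
    - unfold Cnorm2 in HA; simpl in HA. lra.
    - apply cinner_ext; auto; intros. rewrite mapply_vext. ring. }
  destruct (IH A HA' (fun i => A i n)) as [x Hx].
  destruct (IH A HA' b) as [y Hy].
  set (s := Csub (A n n) (mapply n A x n)).
  assert (Hs : im s <> 0).
  { specialize (HA (vext n (vscal (Cneg C1) x) C1)). rewrite sqnorm_vext, cinner_vext in HA.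
    rewrite mapply_vext, mapply_vscal in HA.
    rewrite (cinner_ext n _ (vscal (Cneg C1) x) _ (fun _ => C0)) in HA; auto.
    - replace (cinner n (vscal (Cneg C1) x) (fun _ => C0)) with C0 in HA
        by (symmetry; apply Csum_zero; intros; ring).
      pose proof (sqnorm_nonneg n (vscal (Cneg C1) x)).
      unfold Cnorm2 in HA; unfold s; simpl in *. nra.
    - intros. rewrite mapply_vext, mapply_vscal, Hx by assumption. ring. }
  (* Back substitution: at [(y - t x, t)] the first rows give [b], and the last row reads
     [(A y) n + t s = b n]. *)
  set (t := Cmul (Csub (b n) (mapply n A y n)) (Cinv s)).
  exists (vext n (vadd y (vscal (Cneg t) x)) t). intros i Hi.
  rewrite mapply_vext, mapply_vadd, mapply_vscal.
  destruct (Nat.eq_dec i n) as [->|Hn].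
  - transitivity (Cadd (mapply n A y n) (Cmul t s)); [unfold s; ring|].
    unfold t.
    replace (Cmul (Cmul (Csub (b n) (mapply n A y n)) (Cinv s)) s) with
      (Cmul (Csub (b n) (mapply n A y n)) (Cmul s (Cinv s))) by ring.
    rewrite Cmul_Cinv_r by assumption. ring.
  - rewrite Hx, Hy by lia. ring.
Qed.

Lemma RtoC_Rsum n f : RtoC (Rsum n f) = Csum n (fun i => RtoC (f i)).
Proof.
  apply Cx_eq; simpl; [now rewrite re_Csum|].
  rewrite im_Csum; symmetry; apply Rsum_zero; reflexivity.
Qed.

Lemma RtoC_mul a b : RtoC (a * b) = Cmul (RtoC a) (RtoC b).
Proof. apply Cx_eq; simpl; ring. Qed.

(** * Limits *)

(** The increments telescope against a geometric series, so the sequence is Cauchy. *)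
Lemma Un_cv_of_geometric x D r : 0 <= r < 1 ->
  (forall n, Rabs (x (S n) - x n) <= D * r ^ n) -> exists l, Un_cv x l.
Proof.
  intros Hr Hx.
  assert (HD : 0 <= D).
  { specialize (Hx 0%nat). pose proof (Rabs_pos (x 1%nat - x 0%nat)). simpl in Hx. lra. }
  (* The exact partial sum of the geometric series makes the induction on [k] close with
     equality. *)
  assert (Hk : forall n k, Rabs (x (n + k)%nat - x n) <= D * r ^ n / (1 - r) * (1 - r ^ k)).
  { intros n k. induction k as [|k IH].
    - rewrite Nat.add_0_r, Rminus_diag, Rabs_R0. simpl. lra.
    - rewrite Nat.add_succ_r.
      replace (x (S (n + k)) - x n) with
        ((x (S (n + k)) - x (n + k)%nat) + (x (n + k)%nat - x n)) by ring.
      eapply Rle_trans; [apply Rabs_triang|].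
      eapply Rle_trans; [apply Rplus_le_compat; [apply Hx|apply IH]|].
      apply Req_le. rewrite pow_add. simpl. field. lra. }
  assert (Hk' : forall n k, (n <= k)%nat -> Rabs (x k - x n) <= D / (1 - r) * r ^ n).
  { intros n k Hnk. replace k with (n + (k - n))%nat by lia.
    eapply Rle_trans; [apply Hk|].
    replace (D / (1 - r) * r ^ n) with (D * r ^ n / (1 - r) * 1) by (field; lra).
    apply Rmult_le_compat_l.
    - apply Rmult_le_pos; [|left; apply Rinv_0_lt_compat; lra].
      apply Rmult_le_pos; [assumption|apply pow_le; lra].
    - pose proof (pow_le r (k - n) (proj1 Hr)). lra. }
  destruct (R_complete x) as [l Hl]; [|now exists l].
  intros eps He.
  set (D' := D / (1 - r)) in *.
  assert (HD' : 0 <= D') by (apply Rmult_le_pos; [|left; apply Rinv_0_lt_compat]; lra).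
  (* The [+ 1] keeps the denominator positive when [D'] is zero. *)
  destruct (pow_lt_1_zero r) with (y := eps / (2 * D' + 1)) as [n Hn].
  - rewrite Rabs_pos_eq; lra.
  - apply Rdiv_lt_0_compat; lra.
  - exists n. intros p q Hp Hq. unfold Rdist.
    replace (x p - x q) with ((x p - x n) - (x q - x n)) by ring.
    eapply Rle_lt_trans; [apply Rabs_triang|]. rewrite Rabs_Ropp.
    pose proof (Hk' n p Hp). pose proof (Hk' n q Hq).
    specialize (Hn n (Nat.le_refl n)). rewrite Rabs_pos_eq in Hn by (apply pow_le; lra).
    pose proof (pow_le r n (proj1 Hr)).
    apply (Rmult_lt_compat_r (2 * D' + 1)) in Hn; [|lra].
    unfold Rdiv in Hn. rewrite Rmult_assoc, Rinv_l, Rmult_1_r in Hn by lra. lra.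
Qed.

Lemma Un_cv_eq_const x c : (forall n, x n = c) -> Un_cv x c.
Proof. intros H eps He. exists 0%nat. intros. rewrite H, Rdist_eq. assumption. Qed.

Lemma Un_cv_S x l : Un_cv x l -> Un_cv (fun n => x (S n)) l.
Proof. intros H eps He. destruct (H eps He) as [n Hn]. exists n. intros; apply Hn; lia. Qed.

Lemma Un_cv_lower x l a : (forall n, a <= x n) -> Un_cv x l -> a <= l.
Proof.
  intros Ha Hx. apply Rnot_lt_le; intros Hlt.
  destruct (Hx (a - l)) as [n Hn]; [lra|]. specialize (Hn n (Nat.le_refl n)).
  unfold Rdist in Hn. specialize (Ha n). apply Rabs_def2 in Hn. lra.
Qed.

Definition Ccv (f : nat -> Cx) (l : Cx) : Prop :=
  Un_cv (fun n => re (f n)) (re l) /\ Un_cv (fun n => im (f n)) (im l).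

Lemma Ccv_const c : Ccv (fun _ => c) c.
Proof. split; now apply Un_cv_eq_const. Qed.

Lemma Ccv_S f l : Ccv f l -> Ccv (fun n => f (S n)) l.
Proof. intros [H1 H2]; split; [apply (Un_cv_S _ _ H1) | apply (Un_cv_S _ _ H2)]. Qed.

Lemma Ccv_add f g a b : Ccv f a -> Ccv g b -> Ccv (fun n => Cadd (f n) (g n)) (Cadd a b).
Proof. intros [H1 H2] [H3 H4]; split; simpl; apply CV_plus; assumption. Qed.

Lemma Ccv_mul f g a b : Ccv f a -> Ccv g b -> Ccv (fun n => Cmul (f n) (g n)) (Cmul a b).
Proof.
  intros [H1 H2] [H3 H4]; split; simpl; [apply CV_minus|apply CV_plus]; apply CV_mult; assumption.
Qed.

Lemma Ccv_neg f a : Ccv f a -> Ccv (fun n => Cneg (f n)) (Cneg a).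
Proof. intros [H1 H2]; split; simpl; apply CV_opp; assumption. Qed.

Lemma Ccv_sum k (f : nat -> nat -> Cx) l :
  (forall i, (i < k)%nat -> Ccv (fun n => f n i) (l i)) ->
  Ccv (fun n => Csum k (f n)) (Csum k l).
Proof.
  induction k; intros H; simpl; [apply Ccv_const|].
  apply Ccv_add; [apply IHk; intros; apply H; lia | apply H; lia].
Qed.

Lemma Ccv_unique f a b : Ccv f a -> Ccv f b -> a = b.
Proof.
  intros [H1 H2] [H3 H4]. apply Cx_eq; eapply UL_sequence; eassumption.
Qed.

(** The supremum itself has to be produced: completeness yields it from the bound [c] and from the
    unit vector [basis 0], available since [N] is positive. *)
Lemma opnorm_lt_of_sqnorm_le N A c d : (1 <= N)%nat -> 0 <= c -> c < d ->
  (forall v, sqnorm N (mapply N A v) <= c ^ 2 * sqnorm N v) -> opnorm_lt N A d.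
Proof.
  intros HN Hc Hcd H.
  assert (Hub : is_upper_bound
     (fun r => exists v : Vec, vnorm N v = 1 /\ r = vnorm N (mapply N A v)) c).
  { intros r [v [Hv ->]]. unfold vnorm in *. fold (sqnorm N v) in Hv. fold (sqnorm N (mapply N A v)).
    assert (E : sqnorm N v = 1).
    { rewrite <- (sqrt_sqrt (sqnorm N v)) by apply sqnorm_nonneg. rewrite Hv; ring. }
    rewrite <- (sqrt_pow2 c) by assumption. apply sqrt_le_1_alt.
    specialize (H v). rewrite E in H. lra. }
  destruct (completeness (fun r => exists v : Vec, vnorm N v = 1 /\ r = vnorm N (mapply N A v)))
    as [s Hs].
  - now exists c.
  - exists (vnorm N (mapply N A (basis 0))), (basis 0). split; [|reflexivity].
    unfold vnorm. fold (sqnorm N (basis 0)). rewrite sqnorm_basis by lia. apply sqrt_1.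
  - exists s. split; [exact Hs|]. apply Rle_lt_trans with c; [|assumption]. now apply Hs.
Qed.

(** * The covariance map and the fixed point equation *)

Section CovarianceMap.

Variables (N K : nat) (cov : nat -> nat -> nat -> nat -> R).
Hypothesis HK : (1 <= K)%nat.
Hypothesis HN : (1 <= N)%nat.
Hypothesis Hcov : cov_hyp N K cov.
Variables (m : nat) (B : nat -> nat -> nat -> R).
Hypothesis HB : forall i j k l, (i < N)%nat -> (j < N)%nat -> (k < N)%nat -> (l < N)%nat ->
  xi cov i j k l = Rsum m (fun s => B s i j * B s k l).

(** * Kraus form and norm bound of the covariance map *)

Definition kraus (s : nat) (u : Vec) : Vec :=
  fun j => Csum N (fun i => Cmul (RtoC (B s i j)) (u i)).

(** If [P] is the quadratic form of a matrix [H], this is the form of [Xi(H)]. It is used for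
    [H = Im M] and, with [P] the squared norm, for [H = I]. *)
Definition avg (P : Vec -> R) (u : Vec) : R := / INR N * Rsum m (fun s => P (kraus s u)).

Lemma invN_pos : 0 < / INR N.
Proof. apply Rinv_0_lt_compat, lt_0_INR. exact HN. Qed.

Lemma Xi_form M u v :
  cinner N u (mapply N (XiOp N cov M) v) =
  Cmul (RtoC (/ INR N)) (Csum m (fun s => cinner N (kraus s u) (mapply N M (kraus s v)))).
Proof.
  (* Both sides expand into sums of this common term; the rest is reordering, with [B] real and
     hence untouched by conjugation. *)
  set (T := fun i k j l s => Cmul (Cmul (Cmul (Cconj (u i)) (RtoC (B s i j))) (M j l))
     (Cmul (RtoC (B s k l)) (v k))).
  transitivity (Cmul (RtoC (/ INR N)) (Csum N (fun i => Csum N (fun k => Csum N (fun j =>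
     Csum N (fun l => Csum m (fun s => T i k j l s))))))).
  - unfold cinner, mapply, XiOp. rewrite <- Csum_mul_l. apply Csum_ext; intros i Hi.
    rewrite <- !Csum_mul_l. apply Csum_ext; intros k Hk.
    transitivity (Cmul (RtoC (/ INR N)) (Cmul (Cmul (Cconj (u i)) (v k))
      (Csum N (fun j => Csum N (fun l => Cmul (RtoC (xi cov i j k l)) (M j l)))))); [ring|].
    f_equal. rewrite <- Csum_mul_l. apply Csum_ext; intros j Hj.
    rewrite <- Csum_mul_l. apply Csum_ext; intros l Hl.
    rewrite HB, RtoC_Rsum by assumption. rewrite <- Csum_mul_r, <- Csum_mul_l.
    apply Csum_ext; intros s Hs. rewrite RtoC_mul. unfold T; ring.
  - f_equal. symmetry.
    transitivity (Csum m (fun s => Csum N (fun i => Csum N (fun k => Csum N (fun j =>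
       Csum N (fun l => T i k j l s)))))).
    + apply Csum_ext; intros s Hs. unfold cinner, mapply, kraus.
      transitivity (Csum N (fun j => Csum N (fun i => Csum N (fun l => Csum N (fun k =>
        T i k j l s))))).
      * apply Csum_ext; intros j Hj. rewrite Cconj_Csum, <- Csum_mul_r.
        apply Csum_ext; intros i Hi. rewrite <- Csum_mul_l.
        apply Csum_ext; intros l Hl. rewrite <- !Csum_mul_l.
        apply Csum_ext; intros k Hk. unfold T. rewrite Cconj_mul.
        replace (Cconj (RtoC (B s i j))) with (RtoC (B s i j)) by (apply Cx_eq; simpl; ring).
        ring.
      * rewrite Csum_swap. apply Csum_ext; intros i Hi.
        symmetry. rewrite Csum_swap. apply Csum_ext; intros j Hj.
        apply Csum_swap.
    + rewrite Csum_swap. apply Csum_ext; intros i Hi.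
      rewrite Csum_swap. apply Csum_ext; intros k Hk.
      rewrite Csum_swap. apply Csum_ext; intros j Hj.
      apply Csum_swap.
Qed.

Lemma re_Xi_form M u v :
  re (cinner N u (mapply N (XiOp N cov M) v)) =
  / INR N * Rsum m (fun s => re (cinner N (kraus s u) (mapply N M (kraus s v)))).
Proof. rewrite Xi_form, <- re_Csum. simpl; ring. Qed.

Definition imform (M : Mat) (u : Vec) : R := im (cinner N u (mapply N M u)).

Lemma imform_Xi M u : imform (XiOp N cov M) u = avg (imform M) u.
Proof. unfold imform, avg. rewrite Xi_form, <- im_Csum. simpl; ring. Qed.

Lemma avg_nonneg P u : (forall w, 0 <= P w) -> 0 <= avg P u.
Proof.
  intros H. apply Rmult_le_pos; [left; apply invN_pos|]. apply Rsum_nonneg; intros; apply H.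
Qed.

(** The left side is the form of the column covariance [xi i j k j] at [c]. Close off-diagonal pairs
    are killed by [c], far ones by [K]-dependence; the diagonal entries are at most 1. *)
Lemma column_sum_sqr j c : (j < N)%nat ->
  (forall i k, (i < N)%nat -> (k < N)%nat -> i <> k -> (natdist i k <= K)%nat -> c i * c k = 0) ->
  Rsum m (fun s => Rsum N (fun i => B s i j * c i) * Rsum N (fun i => B s i j * c i))
  <= Rsum N (fun i => c i * c i).
Proof.
  intros Hj Hc.
  replace (Rsum m (fun s => Rsum N (fun i => B s i j * c i) * Rsum N (fun i => B s i j * c i)))
    with (Rsum N (fun i => Rsum N (fun k => c i * c k * xi cov i j k j))).
  - apply Rsum_le; intros i Hi. rewrite (Rsum_single N i); auto.
    + pose proof (xi_diag_le N K cov i j Hcov Hi Hj). pose proof (Rle_0_sqr (c i)).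
      unfold Rsqr in *. nra.
    + intros k Hk Hki. destruct (Nat.le_gt_cases (natdist i k) K).
      * rewrite Hc by auto. ring.
      * rewrite (xi_far N K) by assumption. ring.
  - transitivity (Rsum N (fun i => Rsum N (fun k => Rsum m (fun s =>
      (B s i j * c i) * (B s k j * c k))))).
    + apply Rsum_ext; intros i Hi; apply Rsum_ext; intros k Hk.
      rewrite HB, <- Rsum_mul_l by assumption. apply Rsum_ext; intros; ring.
    + transitivity (Rsum N (fun i => Rsum m (fun s => Rsum N (fun k =>
        (B s i j * c i) * (B s k j * c k))))).
      * apply Rsum_ext; intros; apply Rsum_swap.
      * rewrite Rsum_swap. apply Rsum_ext; intros s Hs.
        rewrite <- Rsum_mul_r. apply Rsum_ext; intros; apply Rsum_mul_l.
Qed.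

(** Distinct indices with the same residue modulo [K + 1] are more than [K] apart, so each class
    falls under the diagonal bound; recombining the [K + 1] classes by Cauchy-Schwarz costs the
    factor [K + 1]. *)
Lemma column_sum_le j x : (j < N)%nat ->
  Rsum m (fun s => Rsum N (fun i => B s i j * x i) * Rsum N (fun i => B s i j * x i))
  <= INR (S K) * Rsum N (fun i => x i * x i).
Proof.
  intros Hj.
  set (c := fun r i => if Nat.eqb (i mod S K) r then x i else 0).
  assert (Hmod : forall i, (i mod S K < S K)%nat) by (intros; apply Nat.mod_upper_bound; lia).
  assert (Hsum : forall s, Rsum N (fun i => B s i j * x i) =
     Rsum (S K) (fun r => Rsum N (fun i => B s i j * c r i))).
  { intros s. rewrite Rsum_swap. apply Rsum_ext; intros i Hi.
    rewrite (Rsum_single (S K) (i mod S K)); auto; unfold c.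
    - now rewrite Nat.eqb_refl.
    - intros r _ Hr. destruct (Nat.eqb_spec (i mod S K) r); [lia|ring]. }
  apply Rle_trans with (Rsum m (fun s => INR (S K) * Rsum (S K) (fun r =>
     Rsum N (fun i => B s i j * c r i) * Rsum N (fun i => B s i j * c r i)))).
  { apply Rsum_le; intros s Hs. rewrite Hsum. apply Rsum_sqr_le. }
  rewrite Rsum_mul_l. apply Rmult_le_compat_l; [apply pos_INR|].
  rewrite Rsum_swap.
  apply Rle_trans with (Rsum (S K) (fun r => Rsum N (fun i => c r i * c r i))).
  - apply Rsum_le; intros r Hr. apply column_sum_sqr; [assumption|].
    intros i k Hi Hk Hik Hd. unfold c.
    destruct (Nat.eqb_spec (i mod S K) r), (Nat.eqb_spec (k mod S K) r); try ring.
    exfalso. unfold natdist in Hd.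
    pose proof (Nat.div_mod i (S K)). pose proof (Nat.div_mod k (S K)).
    (* Equal remainders and distance at most [K] force equal quotients, hence [i = k]. *)
    assert (i / S K = k / S K)%nat by nia. nia.
  - apply Req_le. rewrite Rsum_swap. apply Rsum_ext; intros i Hi.
    rewrite (Rsum_single (S K) (i mod S K)); auto; unfold c.
    + now rewrite Nat.eqb_refl.
    + intros r _ Hr. destruct (Nat.eqb_spec (i mod S K) r); [lia|ring].
Qed.

Lemma avg_sqnorm_le u : avg (sqnorm N) u <= 2 * INR K * sqnorm N u.
Proof.
  assert (H : Rsum m (fun s => sqnorm N (kraus s u)) <= INR N * (INR (S K) * sqnorm N u)).
  { unfold sqnorm at 1. rewrite Rsum_swap, <- Rsum_const. apply Rsum_le; intros j Hj.
    pose proof (column_sum_le j (fun i => re (u i)) Hj) as H1.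
    pose proof (column_sum_le j (fun i => im (u i)) Hj) as H2.
    replace (INR (S K) * sqnorm N u) with (INR (S K) * Rsum N (fun i => re (u i) * re (u i)) +
      INR (S K) * Rsum N (fun i => im (u i) * im (u i))).
    2:{ rewrite <- Rmult_plus_distr_l, <- Rsum_add. reflexivity. }
    eapply Rle_trans; [|apply Rplus_le_compat; [apply H1|apply H2]].
    rewrite <- Rsum_add. apply Req_le, Rsum_ext; intros s Hs.
    unfold Cnorm2, kraus. rewrite re_Csum, im_Csum.
    f_equal; f_equal; apply Rsum_ext; intros; simpl; ring. }
  assert (HNp : 0 < INR N) by (apply lt_0_INR; lia).
  apply (Rmult_le_compat_l (/ INR N)) in H; [|left; apply invN_pos].
  unfold avg. rewrite <- Rmult_assoc, Rinv_l, Rmult_1_l in H by lra.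
  assert (INR (S K) <= 2 * INR K).
  { change 2 with (INR 2). rewrite <- mult_INR. apply le_INR; lia. }
  pose proof (sqnorm_nonneg N u). nra.
Qed.

(** * Coercivity and inversion of [-z - Xi(M)] *)

Variable z : Cx.
Hypothesis Hz : 0 < im z.

Definition res (M : Mat) : Mat := addM (negM (scalM z)) (negM (XiOp N cov M)).

(** Norm bound for [res M] when [M] is [bounded]: the first term controls [Xi(M)], the second [z].
    Its inverse square enters the final lower bound on [Im M]. *)
Definition res_bound : R := 2 * INR K * / im z + Cabs z.

Lemma Cabs_sqr : Cabs z * Cabs z = Cnorm2 z.
Proof.
  apply sqrt_sqrt. unfold Cnorm2. pose proof (Rle_0_sqr (re z)); pose proof (Rle_0_sqr (im z)).
  unfold Rsqr in *; lra.
Qed.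

Lemma im_le_Cabs : im z <= Cabs z.
Proof.
  rewrite <- (sqrt_Rsqr (im z)) by lra. apply sqrt_le_1_alt.
  unfold Cnorm2, Rsqr. pose proof (Rle_0_sqr (re z)). unfold Rsqr in *; lra.
Qed.

Lemma Cabs_lt_res_bound : Cabs z < res_bound.
Proof.
  unfold res_bound. assert (0 < 2 * INR K * / im z); [|lra].
  apply Rmult_lt_0_compat; [|now apply Rinv_0_lt_compat].
  apply Rmult_lt_0_compat; [lra|apply lt_0_INR; exact HK].
Qed.

Lemma res_form M u v :
  cinner N u (mapply N (res M) v) =
  Cneg (Cadd (Cmul z (cinner N u v)) (cinner N u (mapply N (XiOp N cov M) v))).
Proof.
  transitivity (cinner N u (vscal (Cneg C1) (vadd (vscal z v) (mapply N (XiOp N cov M) v)))).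
  - apply cinner_ext; auto; intros. unfold res, vscal, vadd.
    rewrite mapply_addM, !mapply_negM, mapply_scalM by assumption. ring.
  - rewrite cinner_scal_r, cinner_add_r, cinner_scal_r. ring.
Qed.

Definition im_nonneg (M : Mat) : Prop := forall u, 0 <= imform M u.

(* [bounded] says that the operator norm of [M] is at most [1 / im z]; like every norm bound
   below it is phrased additively (AM-GM), so that it can be summed over the Kraus family. *)
Definition bounded (M : Mat) : Prop := forall u v,
  2 * re (cinner N u (mapply N M v)) <= / im z * (sqnorm N u + sqnorm N v).

(** No absolute value is required: replacing [u] by [-u] flips the left side and preserves the
    right. The left vector is weighed by [Im M], the right one by [Im M']. *)
Definition rel_dist (M M' : Mat) (C : R) : Prop := forall u v,
  2 * (re (cinner N u (mapply N M v)) - re (cinner N u (mapply N M' v)))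
  <= C * (imform M u + imform M' v).

(** [F] inverts [res M] rather than [M], so a solution of the equation is a matrix with
    [is_inv M M]. *)
Definition is_inv (M F : Mat) : Prop :=
  (forall v i, (i < N)%nat -> mapply N F (mapply N (res M) v) i = v i) /\
  (forall v i, (i < N)%nat -> mapply N (res M) (mapply N F v) i = v i).

Lemma res_coercive_eq M w :
  - im (cinner N w (mapply N (res M) w)) = im z * sqnorm N w + avg (imform M) w.
Proof.
  rewrite res_form, cinner_self, <- imform_Xi. unfold imform. simpl. ring.
Qed.

Lemma res_coercive M w : im_nonneg M ->
  im z * sqnorm N w <= - im (cinner N w (mapply N (res M) w)).
Proof.
  intros H. rewrite res_coercive_eq. pose proof (avg_nonneg (imform M) w H). lra.
Qed.

Lemma res_injective M x y : im_nonneg M ->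
  (forall i, (i < N)%nat -> mapply N (res M) x i = mapply N (res M) y i) ->
  forall i, (i < N)%nat -> x i = y i.
Proof.
  intros HM H i Hi.
  set (d := vadd x (vscal (Cneg C1) y)).
  assert (Hd : sqnorm N d = 0).
  { pose proof (res_coercive M d HM) as Hc.
    replace (cinner N d (mapply N (res M) d)) with C0 in Hc.
    - pose proof (sqnorm_nonneg N d). simpl in Hc. nra.
    - symmetry; apply Csum_zero; intros k Hk.
      assert (E : mapply N (res M) d k = C0)
        by (unfold d; rewrite mapply_vadd, mapply_vscal, H by assumption; ring).
      rewrite E. ring. }
  apply sqnorm_eq0 with (i := i) in Hd; [|assumption].
  replace (x i) with (Cadd (d i) (y i)) by (unfold d, vadd, vscal; ring).
  rewrite Hd. ring.
Qed.

Lemma is_inv_exists M : im_nonneg M -> exists F, is_inv M F.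
Proof.
  intros HM.
  assert (Hs : forall k, exists x, forall i, (i < N)%nat -> mapply N (res M) x i = basis k i).
  { intros k. apply (coercive_solve (im z) Hz). intros; now apply res_coercive. }
  set (col := fun k => proj1_sig (constructive_indefinite_description _ (Hs k))).
  exists (fun i k => col k i).
  assert (HR : forall v i, (i < N)%nat ->
     mapply N (res M) (mapply N (fun i k => col k i) v) i = v i).
  { intros v i Hi. rewrite <- mapply_mmul, <- (mapply_idM N v i Hi).
    apply mapply_ext; auto; intros k Hk.
    change (mmul N (res M) (fun i k => col k i) i k) with (mapply N (res M) (col k) i).
    unfold col. destruct (constructive_indefinite_description _ (Hs k)) as [x Hx]; simpl.
    now apply Hx. }
  (* A right inverse of an injective matrix is also a left inverse. *)
  split; [|exact HR]. intros v. apply (res_injective M); auto.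
Qed.

(** The equation only provides a left inverse of [res M]; coercivity provides a right inverse [G],
    and the two coincide. *)
Lemma left_inverse_is_inv M F : im_nonneg M ->
  (forall i k, (i < N)%nat -> (k < N)%nat -> mmul N F (res M) i k = idM i k) -> is_inv M F.
Proof.
  intros HM H.
  assert (HL : forall v i, (i < N)%nat -> mapply N F (mapply N (res M) v) i = v i).
  { intros v i Hi. rewrite <- mapply_mmul, <- (mapply_idM N v i Hi). apply mapply_ext; auto. }
  split; [exact HL|]. destruct (is_inv_exists M HM) as [G [_ HG]].
  intros v i Hi. rewrite <- (HG v i Hi). apply mapply_ext; auto; intros j Hj.
  rewrite <- (HL (mapply N G v) j Hj). apply mapply_ext; auto; intros; now rewrite HG.
Qed.

Lemma Xi_bounded M u v : bounded M ->
  2 * re (cinner N u (mapply N (XiOp N cov M) v)) <= 2 * INR K * / im z * (sqnorm N u + sqnorm N v).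
Proof.
  intros HM. rewrite re_Xi_form.
  apply Rle_trans with (/ im z * (avg (sqnorm N) u + avg (sqnorm N) v)).
  - unfold avg. rewrite <- Rmult_plus_distr_l, <- Rsum_add.
    replace (2 * (/ INR N * Rsum m (fun s => re (cinner N (kraus s u) (mapply N M (kraus s v))))))
      with (/ INR N * Rsum m (fun s => 2 * re (cinner N (kraus s u) (mapply N M (kraus s v)))))
      by (rewrite Rsum_mul_l; ring).
    rewrite <- Rmult_assoc, (Rmult_comm (/ im z)), Rmult_assoc.
    apply Rmult_le_compat_l; [left; apply invN_pos|].
    rewrite <- Rsum_mul_l. apply Rsum_le; intros; apply HM.
  - replace (2 * INR K * / im z * (sqnorm N u + sqnorm N v)) with
      (/ im z * (2 * INR K * sqnorm N u + 2 * INR K * sqnorm N v)) by ring.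
    apply Rmult_le_compat_l; [left; now apply Rinv_0_lt_compat|].
    apply Rplus_le_compat; apply avg_sqnorm_le.
Qed.

(** The hypothesis is applied to each pair [kraus s u], [kraus s v] and summed. As it couples two
    vectors, this is complete positivity of [Xi] and not mere positivity. *)
Lemma Xi_rel_dist M M' C u v : rel_dist M M' C ->
  2 * (re (cinner N u (mapply N (XiOp N cov M) v)) - re (cinner N u (mapply N (XiOp N cov M') v)))
  <= C * (avg (imform M) u + avg (imform M') v).
Proof.
  intros HM. rewrite !re_Xi_form. unfold avg. rewrite <- Rmult_plus_distr_l, <- Rsum_add.
  match goal with |- 2 * (_ * Rsum m ?f - _ * Rsum m ?g) <= _ =>
    replace (2 * (/ INR N * Rsum m f - / INR N * Rsum m g)) with
      (/ INR N * Rsum m (fun s => 2 * (f s - g s))) end.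
  - rewrite <- Rmult_assoc, (Rmult_comm C), Rmult_assoc.
    apply Rmult_le_compat_l; [left; apply invN_pos|].
    rewrite <- Rsum_mul_l. apply Rsum_le; intros; apply HM.
  - rewrite Rsum_mul_l, Rsum_sub. ring.
Qed.

Lemma two_re_z_cinner_le t u v : 0 < t ->
  2 * re (Cneg (Cmul z (cinner N u v))) <= Cabs z * (t * sqnorm N u + / t * sqnorm N v).
Proof.
  intros Ht. pose proof im_le_Cabs.
  replace (Cneg (Cmul z (cinner N u v))) with (cinner N (vscal (Cneg (Cconj z)) u) v).
  2:{ rewrite cinner_scal_l. apply Cx_eq; simpl; ring. }
  (* The weight [t / Cabs z] distributes the factor [|z|] evenly over both terms. *)
  eapply Rle_trans; [apply (two_re_cinner_le_weighted N (t / Cabs z))|].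
  - apply Rdiv_lt_0_compat; lra.
  - rewrite sqnorm_scal.
    replace (Cnorm2 (Cneg (Cconj z))) with (Cnorm2 z) by (unfold Cnorm2; simpl; ring).
    rewrite <- Cabs_sqr. apply Req_le. field. lra.
Qed.

Lemma res_bounded M t u v : bounded M -> 0 < t ->
  2 * re (cinner N u (mapply N (res M) v)) <= res_bound * (t * sqnorm N u + / t * sqnorm N v).
Proof.
  intros HM Ht. pose proof (two_re_z_cinner_le t u v Ht) as H1.
  (* Scaling [u] by [- t] yields both the weight [t] and the minus sign in front of [Xi]. *)
  pose proof (Xi_bounded M (vscal (RtoC (- t)) u) v HM) as H2.
  rewrite cinner_scal_l, sqnorm_scal in H2.
  assert (H3 : - (2 * re (cinner N u (mapply N (XiOp N cov M) v))) <=
     2 * INR K * / im z * (t * sqnorm N u + / t * sqnorm N v)).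
  { apply (Rmult_le_reg_l t); [assumption|].
    replace (t * (2 * INR K * / im z * (t * sqnorm N u + / t * sqnorm N v))) with
      (2 * INR K * / im z * (Cnorm2 (RtoC (- t)) * sqnorm N u + sqnorm N v))
      by (unfold Cnorm2; simpl; field; lra).
    eapply Rle_trans; [|exact H2]. simpl. lra. }
  rewrite res_form. unfold res_bound. simpl in *. lra.
Qed.

Section Inverse.

Variables M F : Mat.
Hypothesis HM : im_nonneg M.
Hypothesis HF : is_inv M F.

Lemma adj_inv_form u x :
  cinner N (mapply N (adj F) u) (mapply N (res M) x) = cinner N u x.
Proof.
  rewrite cinner_adj. apply cinner_ext; auto; intros; now apply HF.
Qed.

(** This is [Im F = F (eta + Xi(Im M)) F^*]; the next lemma is the companion
    [F^* (eta + Xi(Im M)) F]. The contraction argument needs one on each side of [F - F']. *)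
Lemma imform_inv_adj u :
  imform F u = im z * sqnorm N (mapply N (adj F) u) + avg (imform M) (mapply N (adj F) u).
Proof.
  rewrite <- res_coercive_eq, adj_inv_form. unfold imform.
  rewrite <- cinner_adj, <- (cinner_conj N u). reflexivity.
Qed.

Lemma imform_inv v :
  imform F v = im z * sqnorm N (mapply N F v) + avg (imform M) (mapply N F v).
Proof.
  rewrite <- res_coercive_eq.
  rewrite (cinner_ext N _ (mapply N F v) _ v) by (auto; intros; now apply HF).
  unfold imform. rewrite <- (cinner_conj N v). simpl. ring.
Qed.

Lemma inv_im_nonneg : im_nonneg F.
Proof.
  intros u. rewrite imform_inv. pose proof (sqnorm_nonneg N (mapply N F u)).
  pose proof (avg_nonneg (imform M) (mapply N F u) HM). nra.
Qed.

(** Coercivity gives [eta |F v|^2 <= Im <v, F v>], and AM-GM with weight [1 / eta] lets half of the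
    right side be absorbed. *)
Lemma sqnorm_inv_le v : im z * sqnorm N (mapply N F v) <= / im z * sqnorm N v.
Proof.
  set (w := mapply N F v).
  assert (H : im z * sqnorm N w <= imform F v).
  { rewrite imform_inv. pose proof (avg_nonneg (imform M) w HM). unfold w in *. lra. }
  assert (H' : 2 * imform F v <= / im z * sqnorm N v + im z * sqnorm N w).
  (* Multiplying [v] by [i] turns the imaginary part of the inner product into a real part. *)
  { pose proof (two_re_cinner_le_weighted N (/ im z) (vscal (mkC 0 1) v) w) as H1.
    rewrite cinner_scal_l, sqnorm_scal, Rinv_inv in H1.
    specialize (H1 (Rinv_0_lt_compat _ Hz)).
    unfold Cnorm2, imform in *; fold w; simpl in *. lra. }
  lra.
Qed.

Lemma inv_bounded : bounded F.
Proof.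
  intros u v. pose proof (sqnorm_inv_le v).
  pose proof (two_re_cinner_le_weighted N (/ im z) u (mapply N F v) (Rinv_0_lt_compat _ Hz)) as H1.
  rewrite Rinv_inv in H1. lra.
Qed.

Lemma imform_inv_le u : imform F u <= / im z * sqnorm N u.
Proof.
  pose proof (inv_bounded (vscal (mkC 0 1) u) u) as H.
  rewrite cinner_scal_l, sqnorm_scal in H. unfold Cnorm2, imform in *; simpl in *.
  lra.
Qed.

Hypothesis HMb : bounded M.

(** [<F^* u, res M u> = |u|^2] while [res M] is bounded by [res_bound]; the weight is chosen so that
    exactly one [|u|^2] is absorbed. *)
Lemma sqnorm_le_adj_inv u : sqnorm N u <= res_bound ^ 2 * sqnorm N (mapply N (adj F) u).
Proof.
  pose proof im_le_Cabs. pose proof Cabs_lt_res_bound.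
  assert (HL : 0 < res_bound) by lra.
  pose proof (res_bounded M res_bound (mapply N (adj F) u) u HMb HL) as H1.
  rewrite adj_inv_form, cinner_self in H1. cbn [re RtoC] in H1.
  rewrite Rmult_plus_distr_l, <- (Rmult_assoc res_bound (/ res_bound)), Rinv_r in H1 by lra.
  simpl. lra.
Qed.

Lemma sqnorm_le_inv v : sqnorm N v <= res_bound ^ 2 * sqnorm N (mapply N F v).
Proof.
  pose proof im_le_Cabs. pose proof Cabs_lt_res_bound.
  assert (HL : 0 < res_bound) by lra.
  pose proof (res_bounded M (/ res_bound) v (mapply N F v) HMb (Rinv_0_lt_compat _ HL)) as H1.
  rewrite (cinner_ext N v v _ v) in H1 by (auto; intros; now apply HF).
  rewrite cinner_self, Rinv_inv in H1. cbn [re RtoC] in H1.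
  rewrite Rmult_plus_distr_l, <- (Rmult_assoc res_bound (/ res_bound)), Rinv_r in H1 by lra.
  simpl. lra.
Qed.

End Inverse.

(** * Contraction in the gauge and uniqueness *)

Definition rate : R := im z ^ 2 * / res_bound ^ 2.

Lemma res_bound_pos : 0 < res_bound.
Proof. pose proof im_le_Cabs. pose proof Cabs_lt_res_bound. lra. Qed.

Lemma rate_bounds : 0 < rate <= 1.
Proof.
  pose proof im_le_Cabs. pose proof Cabs_lt_res_bound. pose proof res_bound_pos. unfold rate.
  assert (0 < res_bound ^ 2) by (apply pow_lt; lra). split.
  - apply Rmult_lt_0_compat; [apply pow_lt; lra|now apply Rinv_0_lt_compat].
  - apply (Rmult_le_reg_r (res_bound ^ 2)); [assumption|].
    rewrite Rmult_assoc, Rinv_l, Rmult_1_r, Rmult_1_l by lra. apply pow_incr; lra.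
Qed.

Lemma div_sqnorm_le x a :
  sqnorm N x <= res_bound ^ 2 * a -> im z * / res_bound ^ 2 * sqnorm N x <= im z * a.
Proof.
  intros H. pose proof res_bound_pos. assert (0 < res_bound ^ 2) by (apply pow_lt; lra).
  rewrite Rmult_assoc. apply Rmult_le_compat_l; [lra|].
  apply (Rmult_le_reg_l (res_bound ^ 2)); [assumption|].
  rewrite <- Rmult_assoc, Rinv_r, Rmult_1_l by lra. assumption.
Qed.

(** This non-strict bound holds after every application of [F] and survives limits; strictness is
    recovered only at the fixed point. *)
Lemma inv_imform_lower M F u : im_nonneg M -> bounded M -> is_inv M F ->
  im z * / res_bound ^ 2 * sqnorm N u <= imform F u.
Proof.
  intros HM HMb HF. rewrite (imform_inv M F HF).
  pose proof (div_sqnorm_le _ _ (sqnorm_le_inv M F HF HMb u)).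
  pose proof (avg_nonneg (imform M) (mapply N F u) HM). lra.
Qed.

(** Explains [rate]: it is the ratio of the lower bound [eta / res_bound^2] for [eta * a] to the
    upper bound [1 / eta] for [Im F], per unit of [|u|^2]. *)
Lemma rate_imform_le M F u a : im_nonneg M -> is_inv M F ->
  sqnorm N u <= res_bound ^ 2 * a -> rate * imform F u <= im z * a.
Proof.
  intros HM HF H.
  apply Rle_trans with (im z * / res_bound ^ 2 * sqnorm N u); [|now apply div_sqnorm_le].
  pose proof (imform_inv_le M F HM HF u) as H1. unfold rate.
  pose proof res_bound_pos. assert (0 < / res_bound ^ 2) by (apply Rinv_0_lt_compat, pow_lt; lra).
  replace (im z ^ 2 * / res_bound ^ 2 * imform F u) with
    (im z * / res_bound ^ 2 * (im z * imform F u)) by ring.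
  apply Rmult_le_compat_l; [nra|].
  apply (Rmult_le_compat_l (im z)) in H1; [|lra].
  rewrite <- Rmult_assoc, Rinv_r, Rmult_1_l in H1 by lra. assumption.
Qed.

(* With [w = F^* u] and [w' = F' v], [<u, (F - F') v> = <w, (Xi M - Xi M') w'>], and
   [imform F u] exceeds [<w, Xi (Im M) w>] by [im z * |w|^2], which is where the gain comes from. *)
Lemma rel_dist_contract M M' F F' C :
  im_nonneg M -> bounded M -> is_inv M F ->
  im_nonneg M' -> bounded M' -> is_inv M' F' ->
  0 <= C -> rel_dist M M' C -> rel_dist F F' (C * (1 - rate)).
Proof.
  intros HM HMb HF HM' HMb' HF' HC HD u v.
  pose (w := mapply N (adj F) u). pose (w' := mapply N F' v).
  assert (E : re (cinner N u (mapply N F v)) - re (cinner N u (mapply N F' v)) =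
    re (cinner N w (mapply N (XiOp N cov M) w')) - re (cinner N w (mapply N (XiOp N cov M') w'))).
  { assert (E1 : cinner N u (mapply N F v) = cinner N w (mapply N (res M') w')).
    { unfold w. rewrite <- cinner_adj. apply cinner_ext; auto; intros. symmetry; now apply HF'. }
    assert (E2 : cinner N u (mapply N F' v) = cinner N w (mapply N (res M) w')).
    { symmetry; apply (adj_inv_form M F HF). }
    rewrite E1, E2, !res_form. simpl. ring. }
  rewrite E. eapply Rle_trans; [apply Xi_rel_dist, HD|].
  rewrite Rmult_assoc. apply Rmult_le_compat_l; [assumption|].
  pose proof (imform_inv_adj M F HF u) as I1. pose proof (imform_inv M' F' HF' v) as I2.
  pose proof (rate_imform_le M F u _ HM HF (sqnorm_le_adj_inv M F HF HMb u)) as R1.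
  pose proof (rate_imform_le M' F' v _ HM' HF' (sqnorm_le_inv M' F' HF' HMb' v)) as R2.
  fold w in I1, R1. fold w' in I2, R2. lra.
Qed.

(** The norm bound [2 / eta] on a difference, times the factor [res_bound^2 / eta] that converts
    squared norms into imaginary forms. *)
Definition rel_const : R := 2 * / im z * (res_bound ^ 2 * / im z).

Lemma rel_const_nonneg : 0 <= rel_const.
Proof.
  unfold rel_const. pose proof res_bound_pos. assert (0 < res_bound ^ 2) by (apply pow_lt; lra).
  pose proof (Rinv_0_lt_compat _ Hz). repeat apply Rmult_le_pos; lra.
Qed.

Lemma rel_dist_initial M M' :
  bounded M -> bounded M' ->
  (forall u, im z * / res_bound ^ 2 * sqnorm N u <= imform M u) ->
  (forall u, im z * / res_bound ^ 2 * sqnorm N u <= imform M' u) ->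
  rel_dist M M' rel_const.
Proof.
  intros Hb Hb' Hl Hl' u v.
  pose proof (Hb u v) as H1. pose proof (Hb' (vscal (Cneg C1) u) v) as H2.
  rewrite cinner_scal_l, sqnorm_scal in H2. unfold Cnorm2 in H2; simpl in H2.
  apply Rle_trans with (2 * / im z * (sqnorm N u + sqnorm N v)); [lra|].
  unfold rel_const. rewrite (Rmult_assoc (2 * / im z)).
  pose proof (Rinv_0_lt_compat _ Hz). apply Rmult_le_compat_l; [lra|].
  pose proof res_bound_pos. assert (0 < res_bound ^ 2) by (apply pow_lt; lra).
  replace (sqnorm N u + sqnorm N v) with
    (res_bound ^ 2 * / im z *
      (im z * / res_bound ^ 2 * sqnorm N u + im z * / res_bound ^ 2 * sqnorm N v)) by (field; lra).
  apply Rmult_le_compat_l; [apply Rmult_le_pos; lra|].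
  specialize (Hl u); specialize (Hl' v). lra.
Qed.

Lemma geometric_lt C eps : 0 < eps -> exists n, C * (1 - rate) ^ n < eps.
Proof.
  intros He. pose proof rate_bounds.
  destruct (Rle_or_lt C 0) as [HC|HC].
  - exists 0%nat. simpl. lra.
  - destruct (pow_lt_1_zero (1 - rate)) with (y := eps / C) as [n Hn].
    + rewrite Rabs_pos_eq; lra.
    + now apply Rdiv_lt_0_compat.
    + exists n. specialize (Hn n (Nat.le_refl n)).
      pose proof (Rle_abs ((1 - rate) ^ n)).
      apply (Rmult_lt_reg_r (/ C)); [now apply Rinv_0_lt_compat|].
      replace (C * (1 - rate) ^ n * / C) with ((1 - rate) ^ n) by (field; lra).
      fold (eps / C). lra.
Qed.

(** Both matrices are their own images, so the contraction can be applied to the same pair any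
    number of times and drives the gauge to zero. *)
Lemma fixed_point_unique M M' :
  im_nonneg M -> is_inv M M -> im_nonneg M' -> is_inv M' M' ->
  forall i j, (i < N)%nat -> (j < N)%nat -> M' i j = M i j.
Proof.
  intros HM HF HM' HF'.
  pose proof (inv_bounded M M HM HF) as Hb. pose proof (inv_bounded M' M' HM' HF') as Hb'.
  assert (Hn : forall n, rel_dist M M' (rel_const * (1 - rate) ^ n)).
  { pose proof rate_bounds. pose proof rel_const_nonneg. induction n.
    - simpl. rewrite Rmult_1_r. apply rel_dist_initial; auto; intros;
        [apply (inv_imform_lower M M) | apply (inv_imform_lower M' M')]; auto.
    - simpl. rewrite (Rmult_comm (1 - rate)), <- Rmult_assoc.
      apply (rel_dist_contract M M' M M'); auto.
      apply Rmult_le_pos; [assumption|apply pow_le; lra]. }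
  assert (Hle : forall u v, re (cinner N u (mapply N M v)) <= re (cinner N u (mapply N M' v))).
  { intros u v. apply Rnot_lt_le; intros Hlt.
    set (d := re (cinner N u (mapply N M v)) - re (cinner N u (mapply N M' v))).
    set (q := imform M u + imform M' v).
    assert (0 <= q) by (specialize (HM u); specialize (HM' v); unfold q; lra).
    destruct (geometric_lt (rel_const * q) d) as [n Hlt']; [unfold d; lra|].
    specialize (Hn n u v). fold d q in Hn.
    assert (0 < d) by (unfold d; lra). lra. }
  intros i j Hi Hj.
  (* The values 1, -1, [i], [-i] of [a] turn this one-sided inequality into equality of real and
     imaginary parts. *)
  assert (Hc : forall a, re (Cmul (Cconj a) (M i j)) <= re (Cmul (Cconj a) (M' i j))).
  { intros a. specialize (Hle (vscal a (basis i)) (basis j)).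
    now rewrite !cinner_scal_l, !cinner_basis_l, !mapply_basis in Hle. }
  pose proof (Hc C1). pose proof (Hc (Cneg C1)).
  pose proof (Hc (mkC 0 1)). pose proof (Hc (mkC 0 (-1))).
  apply Cx_eq; simpl in *; lra.
Qed.

(** * Existence by iteration *)

Definition step (M : Mat) : Mat :=
  epsilon (inhabits idM) (fun F => is_inv M F).

Lemma step_spec M : im_nonneg M -> is_inv M (step M).
Proof. intros HM. unfold step. apply epsilon_spec. now apply is_inv_exists. Qed.

(** Zero is [im_nonneg] and [bounded] but has no lower bound on its imaginary part, so gauge
    estimates start at index 1. *)
Fixpoint iterate (n : nat) : Mat :=
  match n with O => fun _ _ => C0 | S n => step (iterate n) end.

Lemma cinner_mapply_zero u v : cinner N u (mapply N (fun _ _ => C0) v) = C0.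
Proof.
  apply Csum_zero; intros. unfold mapply. rewrite Csum_zero by (intros; ring). ring.
Qed.

Lemma iterate_good n : im_nonneg (iterate n) /\ bounded (iterate n).
Proof.
  induction n as [|n [IH1 IH2]]; simpl.
  - split.
    + intros u. unfold imform. rewrite cinner_mapply_zero. simpl; lra.
    + intros u v. rewrite cinner_mapply_zero. simpl.
      pose proof (sqnorm_nonneg N u); pose proof (sqnorm_nonneg N v).
      pose proof (Rinv_0_lt_compat _ Hz).
      rewrite Rmult_0_r. apply Rmult_le_pos; lra.
  - pose proof (step_spec _ IH1). split; [eapply inv_im_nonneg|eapply inv_bounded]; eauto.
Qed.

Lemma iterate_inv n : is_inv (iterate n) (iterate (S n)).
Proof. apply step_spec, iterate_good. Qed.

Lemma iterate_imform_lower n u : im z * / res_bound ^ 2 * sqnorm N u <= imform (iterate (S n)) u.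
Proof. apply (inv_imform_lower (iterate n)); [apply iterate_good..|apply iterate_inv]. Qed.

Lemma iterate_rel_dist n :
  rel_dist (iterate (S (S n))) (iterate (S n)) (rel_const * (1 - rate) ^ n).
Proof.
  pose proof rate_bounds. pose proof rel_const_nonneg.
  induction n as [|n IH].
  - simpl pow. rewrite Rmult_1_r.
    apply rel_dist_initial; try apply iterate_good; apply iterate_imform_lower.
  - simpl pow. rewrite (Rmult_comm (1 - rate)), <- Rmult_assoc.
    apply (rel_dist_contract (iterate (S (S n))) (iterate (S n)));
      try apply iterate_good; try apply iterate_inv.
    + apply Rmult_le_pos; [assumption|apply pow_le; lra].
    + assumption.
Qed.

(** The gauge controls entries because [Im F <= 1 / eta]; the phase [a] selects the sign and the
    real or imaginary part. *)
Lemma iterate_entry_step n a i j : (i < N)%nat -> (j < N)%nat -> Cnorm2 a = 1 ->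
  re (Cmul a (iterate (S (S n)) i j)) - re (Cmul a (iterate (S n) i j))
  <= rel_const * / im z * (1 - rate) ^ n.
Proof.
  intros Hi Hj Ha.
  pose proof (iterate_rel_dist n (vscal (Cconj a) (basis i)) (basis j)) as H.
  rewrite !cinner_scal_l, !cinner_basis_l, !mapply_basis, Cconj_invol in H by assumption.
  pose proof (imform_inv_le _ _ (proj1 (iterate_good (S n))) (iterate_inv (S n))
    (vscal (Cconj a) (basis i))) as H1.
  pose proof (imform_inv_le _ _ (proj1 (iterate_good n)) (iterate_inv n) (basis j)) as H2.
  rewrite sqnorm_scal, sqnorm_basis in H1 by assumption. rewrite sqnorm_basis in H2 by assumption.
  replace (Cnorm2 (Cconj a)) with 1 in H1 by (rewrite <- Ha; unfold Cnorm2; simpl; ring).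
  assert (H3 : 0 <= rel_const * (1 - rate) ^ n).
  { pose proof rate_bounds.
    apply Rmult_le_pos; [apply rel_const_nonneg|apply pow_le; lra]. }
  apply (Rmult_le_reg_l 2); [lra|]. eapply Rle_trans; [exact H|].
  replace (2 * (rel_const * / im z * (1 - rate) ^ n)) with
    (rel_const * (1 - rate) ^ n * (/ im z * (1 * 1) + / im z * 1)) by ring.
  apply Rmult_le_compat_l; [assumption|]. apply Rplus_le_compat; assumption.
Qed.

(** The index bounds stay under the existential so that [epsilon] can choose a limit for all [i],
    [j] at once. *)
Lemma iterate_entry_cv i j : exists l, (i < N)%nat -> (j < N)%nat ->
  Ccv (fun n => iterate (S n) i j) l.
Proof.
  destruct (Nat.lt_ge_cases i N) as [Hi|Hi]; [|exists C0; lia].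
  destruct (Nat.lt_ge_cases j N) as [Hj|Hj]; [|exists C0; lia].
  pose proof rate_bounds.
  destruct (Un_cv_of_geometric (fun n => re (iterate (S n) i j)) (rel_const * / im z) (1 - rate))
    as [x Hx]; [lra| |].
  { intros n. apply Rabs_le.
    assert (E1 : Cnorm2 C1 = 1) by (unfold Cnorm2; simpl; ring).
    assert (E2 : Cnorm2 (Cneg C1) = 1) by (unfold Cnorm2; simpl; ring).
    pose proof (iterate_entry_step n _ i j Hi Hj E1) as H1.
    pose proof (iterate_entry_step n _ i j Hi Hj E2) as H2.
    cbn [re im Cmul Cneg C1] in H1, H2. lra. }
  destruct (Un_cv_of_geometric (fun n => im (iterate (S n) i j)) (rel_const * / im z) (1 - rate))
    as [y Hy]; [lra| |].
  { intros n. apply Rabs_le.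
    assert (E1 : Cnorm2 (mkC 0 1) = 1) by (unfold Cnorm2; simpl; ring).
    assert (E2 : Cnorm2 (mkC 0 (-1)) = 1) by (unfold Cnorm2; simpl; ring).
    pose proof (iterate_entry_step n _ i j Hi Hj E1) as H1.
    pose proof (iterate_entry_step n _ i j Hi Hj E2) as H2.
    cbn [re im Cmul] in H1, H2. lra. }
  exists (mkC x y). split; assumption.
Qed.

Lemma fixed_point_exists : exists M,
  (forall u, im z * / res_bound ^ 2 * sqnorm N u <= imform M u) /\
  (forall i k, (i < N)%nat -> (k < N)%nat -> mmul N M (res M) i k = idM i k).
Proof.
  exists (fun i j => epsilon (inhabits C0) (fun l => (i < N)%nat -> (j < N)%nat ->
     Ccv (fun n => iterate (S n) i j) l)).
  set (M := fun i j => _).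
  assert (HM : forall i j, (i < N)%nat -> (j < N)%nat -> Ccv (fun n => iterate (S n) i j) (M i j)).
  { intros i j. unfold M. apply epsilon_spec, iterate_entry_cv. }
  split.
  - intros u.
    assert (Hc : Ccv (fun n => cinner N u (mapply N (iterate (S n)) u)) (cinner N u (mapply N M u))).
    { unfold cinner, mapply.
      apply Ccv_sum; intros i Hi. apply Ccv_mul; [apply Ccv_const|].
      apply Ccv_sum; intros j Hj. apply Ccv_mul; [now apply HM|apply Ccv_const]. }
    apply (Un_cv_lower _ _ _ (fun n => iterate_imform_lower n u)). apply Hc.
  - intros i k Hi Hk.
    (* This sequence is constantly [idM i k], and by continuity it also tends to the entry of [M]
       times [res M]. *)
    apply (Ccv_unique (fun n => mmul N (iterate (S (S n))) (res (iterate (S n))) i k)).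
    + unfold mmul. apply Ccv_sum; intros j Hj.
      apply Ccv_mul; [apply (Ccv_S _ _ (HM i j Hi Hj))|].
      unfold res, addM, negM, XiOp. apply Ccv_add; [apply Ccv_const|].
      apply Ccv_neg, Ccv_mul; [apply Ccv_const|].
      apply Ccv_sum; intros p Hp. apply Ccv_sum; intros q Hq.
      apply Ccv_mul; [apply Ccv_const|now apply HM].
    + assert (E : forall n, mmul N (iterate (S (S n))) (res (iterate (S n))) i k = idM i k).
      { intros n. rewrite <- (mapply_basis N _ i k Hk), mapply_mmul.
        rewrite (proj1 (iterate_inv (S n))) by assumption. reflexivity. }
      split;
        [apply (Un_cv_eq_const _ _ (fun n => f_equal re (E n)))
        |apply (Un_cv_eq_const _ _ (fun n => f_equal im (E n)))].
Qed.

(* If the Kraus vectors of [u = M^* v] all vanish then [v = - conj z * u] exactly, so the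
   strict inequality comes from [|z| < res_bound]; otherwise [Im Xi M] contributes strictly. *)
Lemma fixed_point_imform_gt M v :
  (forall u, im z * / res_bound ^ 2 * sqnorm N u <= imform M u) -> is_inv M M -> bounded M ->
  vnonzero N v -> im z * / res_bound ^ 2 * sqnorm N v < imform M v.
Proof.
  intros Hl HF Hb Hv. pose proof (sqnorm_pos N v Hv) as Hv'.
  pose proof res_bound_pos. assert (HL2 : 0 < res_bound ^ 2) by (apply pow_lt; lra).
  assert (Hc0 : 0 < im z * / res_bound ^ 2)
    by (apply Rmult_lt_0_compat; [assumption|now apply Rinv_0_lt_compat]).
  assert (HM : im_nonneg M).
  { intros w. specialize (Hl w). pose proof (sqnorm_nonneg N w). nra. }
  pose proof (imform_inv_adj M M HF v) as I. pose proof (sqnorm_le_adj_inv M M HF Hb v) as Hn.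
  pose proof (div_sqnorm_le _ _ Hn) as Hn'.
  set (u := mapply N (adj M) v) in *.
  destruct (Rle_lt_or_eq_dec _ _ (avg_nonneg (imform M) u HM)) as [Hq|Hq]; [lra|].
  (* A zero average of nonnegative terms makes each term zero, and the lower bound [Hl] then kills
     each Kraus vector. *)
  assert (Htw : forall s, (s < m)%nat -> sqnorm N (kraus s u) = 0).
  { intros s Hs. unfold avg in Hq.
    assert (Hsum : Rsum m (fun s => imform M (kraus s u)) = 0).
    { pose proof invN_pos. symmetry in Hq. apply Rmult_integral in Hq. destruct Hq; lra. }
    assert (E := Rsum_nonneg_eq0 m _ (fun s _ => HM (kraus s u)) Hsum s Hs). cbv beta in E.
    specialize (Hl (kraus s u)). pose proof (sqnorm_nonneg N (kraus s u)). nra. }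
  assert (HXi : cinner N u (mapply N (XiOp N cov M) v) = C0).
  { rewrite Xi_form, Csum_zero; [ring|]. intros s Hs. apply Csum_zero; intros i Hi.
    rewrite (sqnorm_eq0 N _ (Htw s Hs)) by assumption. apply Cx_eq; simpl; ring. }
  pose proof (adj_inv_form M M HF v v) as Hvv. fold u in Hvv.
  rewrite res_form, HXi, cinner_self in Hvv.
  pose proof Cabs_lt_res_bound as HzL. pose proof im_le_Cabs as Hzz.
  assert (Hz0 : 0 < Cabs z) by lra.
  (* With [|v|^2 = - z <u, v>], the weight [Cabs z] leads to [|v|^2 <= |z|^2 |u|^2]. *)
  pose proof (two_re_z_cinner_le (Cabs z) u v Hz0) as H1.
  apply (f_equal re) in Hvv. simpl in Hvv, H1.
  rewrite Rmult_plus_distr_l, <- (Rmult_assoc (Cabs z) (/ Cabs z)), Rinv_r in H1 by lra.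
  assert (H2 : sqnorm N v <= Cabs z * Cabs z * sqnorm N u) by lra.
  assert (Hu : 0 < sqnorm N u) by (pose proof (sqnorm_nonneg N u); nra).
  assert (H3 : Cabs z * Cabs z < res_bound * res_bound) by nra.
  assert (H4 : sqnorm N v < res_bound ^ 2 * sqnorm N u) by (simpl; nra).
  rewrite I, <- Hq, Rplus_0_r, Rmult_assoc.
  apply Rmult_lt_compat_l; [assumption|].
  apply (Rmult_lt_reg_l (res_bound ^ 2)); [assumption|].
  rewrite <- Rmult_assoc, Rinv_r, Rmult_1_l by lra. assumption.
Qed.

End CovarianceMap.

Theorem theorem4p6 (K : nat) (HK : (1 <= K)%nat) (N : nat) (HN : (1 <= N)%nat)
  (cov : nat -> nat -> nat -> nat -> R) (Hcov : cov_hyp N K cov)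
  (z : Cx) (Hz : 0 < im z) :
  exists M : Mat,
    MplusN N M /\ MDE N cov z M /\
    (forall M' : Mat, MplusN N M' -> MDE N cov z M' ->
       forall i j, (i < N)%nat -> (j < N)%nat -> M' i j = M i j) /\
    MN N (im z * / (2 * INR K * / im z + Cabs z) ^ 2) (4 * / im z) M.
Proof.
  destruct (xi_factorization N K cov Hcov) as [m [B HB]].
  destruct (fixed_point_exists N K cov HK HN Hcov m B HB z Hz) as [M [HMl HMe]].
  assert (HL2 : 0 < im z * / res_bound K z ^ 2).
  { apply Rmult_lt_0_compat; [assumption|].
    apply Rinv_0_lt_compat, pow_lt, (res_bound_pos K HK z Hz). }
  assert (HM : im_nonneg N M).
  { intros u. eapply Rle_trans; [|apply HMl]. apply Rmult_le_pos; [lra|apply sqnorm_nonneg]. }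
  assert (HF : is_inv N cov z M M)
    by (apply (left_inverse_is_inv N cov HN m B HB z Hz); assumption).
  assert (Hb : bounded N z M) by (eapply inv_bounded; eassumption).
  assert (Hgt : herm_gt N (ImM M) (im z * / res_bound K z ^ 2)).
  { intros v Hv. rewrite re_cinner_ImM, cinner_self.
    pose proof (fixed_point_imform_gt N K cov HK HN Hcov m B HB z Hz M v HMl HF Hb Hv) as H.
    unfold imform in H. simpl re. lra. }
  exists M. split; [|split; [exact HMe|split; [|split; [exact Hgt|]]]].
  - intros v Hv. specialize (Hgt v Hv). pose proof (sqnorm_pos N v Hv).
    rewrite cinner_self in *. cbn [re RtoC] in *. nra.
  - intros M' HM' HE'.
    (* [MplusN] only speaks of vectors with a nonzero entry below [N]; for the others the form is
       zero. *)
    assert (Hn' : im_nonneg N M').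
    { intros u. unfold imform. rewrite <- re_cinner_ImM.
      destruct (Rle_lt_or_eq_dec _ _ (sqnorm_nonneg N u)) as [Hu|Hu].
      - assert (Hnz : vnonzero N u).
        { apply NNPP; intros Hn. assert (sqnorm N u = 0); [|lra].
          apply Rsum_zero; intros i Hi. destruct (excluded_middle_informative (u i = C0)) as [E|E].
          - rewrite E. unfold Cnorm2; simpl; ring.
          - elim Hn. now exists i. }
        specialize (HM' u Hnz). lra.
      - replace (cinner N u (mapply N (ImM M') u)) with C0; [simpl; lra|].
        symmetry; apply Csum_zero; intros i Hi.
        rewrite (sqnorm_eq0 N u (eq_sym Hu)) by assumption. apply Cx_eq; simpl; ring. }
    apply (fixed_point_unique N K cov HK HN Hcov m B HB z Hz); try assumption.
    apply (left_inverse_is_inv N cov HN m B HB z Hz); assumption.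
  (* The norm is in fact at most [1 / eta], which gives the strict bound by [4 / eta]. *)
  - apply (opnorm_lt_of_sqnorm_le N M (/ im z)); [assumption| | |].
    + left; now apply Rinv_0_lt_compat.
    + pose proof (Rinv_0_lt_compat _ Hz). lra.
    + intros v. pose proof (sqnorm_inv_le N cov HN m B HB z Hz M M HM HF v) as H.
      apply (Rmult_le_compat_l (/ im z)) in H; [|left; now apply Rinv_0_lt_compat].
      rewrite <- Rmult_assoc, Rinv_l, Rmult_1_l in H by lra. simpl. lra.
Qed.
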